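(* Let $(c_l)_{l\in\mathbb{Z}}$ be complex numbers with $c_l\to 0$ as $|l|\to\infty$, and let $(n_k)_{k\ge 1}$ be a sequence of positive integers with $n_k\to\infty$ such that $$\lim_{k\to\infty}\sum_{l=-n_k}^{n_k}c_l e^{ilx}=0\qquad\text{for every }x\in[0,2\pi].$$ Assume further that $n_{k+1}=n_k^{1+o(1)}$ as $k\to\infty$. Then $c_l=0$ for all $l\in\mathbb{Z}$.
   Context: The condition $n_{k+1}=n_k^{1+o(1)}$ means $\log n_{k+1}/\log n_k\to 1$ as $k\to\infty$. *)

(* Defs.v *)
(* The normed (hence topological) structure of [R[i]] given by the complex
   modulus is carried by its alias [R[i]^o]. *)
From HB Require Import structures.
From mathcomp Require Import all_boot all_order all_algebra.
From mathcomp Require Export complex.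
From mathcomp Require Import all_classical all_reals all_analysis.

Set Implicit Arguments.
Unset Strict Implicit.
Unset Printing Implicit Defensive.

Import Order.TTheory GRing.Theory Num.Theory.
Import numFieldNormedType.Exports.

Local Open Scope classical_set_scope.
Local Open Scope ring_scope.
Local Open Scope complex_scope.

(* The filter "|l| -> oo". *)
Definition absz_infty : set_system int :=
  filter_from [set: nat] (fun N : nat => [set l : int | (N <= `|l|)%N]).

#[global] Instance absz_infty_filter : ProperFilter absz_infty.
Proof.
apply: filter_from_proper; last by move=> N _; exists N%:Z => /=.
apply: filter_from_filter; first by exists 0%N.
move=> M N _ _; exists (maxn M N) => // l /=.
by rewrite geq_max => /andP[].
Qed.

(* e^{it} for real t, defined by Euler's formula. *)
Definition expi (R : realType) (t : R) : R[i] := cos t +i* sin t.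

(* \sum_{l = -n}^{n} c_l e^{ilx}: the index j in {0, ..., 2n} stands for
   l = j - n. *)
Definition trig_psum (R : realType) (c : int -> R[i]) (n : nat) (x : R) : R[i] :=
  \sum_(0 <= j < (2 * n).+1)
     c (j%:Z - n%:Z) * expi ((j%:Z - n%:Z)%:~R * x).

(* Main.v *)
(* Suppose [c <> 0] and regard [F = \sum_l c_l e^{ilx}] as a distribution.

   By Baire's theorem the sums [S_{n_k}] are uniformly bounded on a portion of
   the support of [F].  Multiplying [F] by a test function carried by that
   portion (Riemann's localization principle, where [c_l -> 0] is used) gives
   [d <> 0] whose sums [S_{n_k}] still tend to [0] pointwise and are bounded on a
   set [K] carrying the support of [\sum_l d_l e^{ilx}].

   Let [a(n) = \sum_{|l| <= n} |d_l|^2].  If [a] were bounded, Fatou's lemma would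
   bound [a(n_k)] by the tail of [\sum_l |d_l|^2], forcing [d = 0].

   On the other hand, convolve [\sum_l d_l e^{ilx}] with the B-spline of Fourier
   coefficients [sinc(lh)^4], [h = n^{-3/2}], [n = n_k].  The result [g] lives within
   [4h] of [K], where Taylor's formula at the nearest point of [K] bounds [S_n] in
   mean square.  Pairing [S_n] with [g] and applying Cauchy-Schwarz gives
   [a(n)^2 <= C (a(N) + C')] once [N^7 >= n^12].  The growth condition provides
   some [N = n_j] with [n^12 <= N^7 <= n^13].  Hence, if [a] is unbounded, [log a]
   doubles at each step while [log n] is multiplied by at most [13/7 < 2],
   contradicting [a(n) = O(n)]. *)
Require Import Defs.
From HB Require Import structures.
From mathcomp Require Import all_boot all_order all_algebra.
From mathcomp Require Import complex.
From mathcomp Require Import all_classical all_reals all_analysis.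
From mathcomp Require Import ring lra zify.

Set Implicit Arguments.
Unset Strict Implicit.
Unset Printing Implicit Defensive.

Import Order.TTheory GRing.Theory Num.Theory.
Import numFieldNormedType.Exports.

Local Open Scope classical_set_scope.
Local Open Scope ring_scope.
Local Open Scope complex_scope.

(** The scale [h] has to make Taylor's formula harmless: at distance [O(h)] the second-order
    remainder of [S_n] is [O(h^2 n^3)], and so is the mean square of [h S_n'], whence
    [h = n^{-3/2}]. With a spline of coefficients [sinc(lh)^p], the energy of [g] beyond [N] is
    [O(h^{-2p} N^{1-2p})], which is bounded as soon as [N >= n^{3p/(2p-1)}]. This exponent must be
    below [2] for the doubling of [log a] to win: [p = 2] gives exactly [2], whereas [p = 4] gives
    [12/7], and the room up to [13/7] absorbs the [o(1)] of the growth condition.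

    No integral over [K] is ever formed. Test functions are given by absolutely summable
    coefficients, supports are controlled through the factorization of [sinc] into cosines, and mean
    squares of trigonometric polynomials are averages over a regular grid fine enough to be exact.
    Only Fatou's lemma calls for Lebesgue integration. *)

Local Notation cn := Normc.normc.

(** * Unconditional sums *)

Section Modulus.
Variable R : realType.
Implicit Types z w : R[i].

Lemma cn_ge0 z : 0 <= cn z.
Proof. by case: z => a b; exact: sqrtr_ge0. Qed.

Lemma cn0 : cn (0 : R[i]) = 0. Proof. exact: Normc.normc0. Qed.

Lemma cnM z w : cn (z * w) = cn z * cn w. Proof. exact: Normc.normcM. Qed.

Lemma cnD z w : cn (z + w) <= cn z + cn w. Proof. exact: le_normcD. Qed.

Lemma cnN z : cn (- z) = cn z. Proof. exact: normcN. Qed.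

Lemma cnB z w : cn (z - w) = cn (w - z).
Proof. by rewrite -[LHS]cnN opprB. Qed.

Lemma cn_triB z w : cn (z - w) <= cn z + cn w.
Proof. by rewrite -[cn w]cnN cnD. Qed.

Lemma cn_dist u z w : cn (z - w) <= cn (z - u) + cn (u - w).
Proof. by rewrite -{1}(subrK u z) -addrA cnD. Qed.

Lemma cn_real (x : R) : cn x%:C = `|x|.
Proof. by rewrite /= expr0n addr0 sqrtr_sqr. Qed.

Lemma cn_sqr z : cn z ^+ 2 = complex.Re z ^+ 2 + complex.Im z ^+ 2.
Proof. by case: z => a b; rewrite sqr_sqrtr // addr_ge0 // sqr_ge0. Qed.

Lemma cn_Re z : `|complex.Re z| <= cn z.
Proof.
rewrite -ler_sqr ?nnegrE ?cn_ge0 // cn_sqr real_normK ?num_real //.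
by rewrite lerDl sqr_ge0.
Qed.

Lemma cn_Im z : `|complex.Im z| <= cn z.
Proof.
rewrite -ler_sqr ?nnegrE ?cn_ge0 // cn_sqr real_normK ?num_real //.
by rewrite lerDr sqr_ge0.
Qed.

Lemma cn_le z : cn z <= `|complex.Re z| + `|complex.Im z|.
Proof.
rewrite -ler_sqr ?nnegrE ?cn_ge0 ?addr_ge0 // cn_sqr sqrrD.
rewrite !real_normK ?num_real // -addrA [X in _ <= _ + X]addrC addrA lerDl.
by rewrite mulrn_wge0 // mulr_ge0.
Qed.

Lemma cn_sum (I : Type) (s : seq I) (F : I -> R[i]) :
  cn (\sum_(i <- s) F i) <= \sum_(i <- s) cn (F i).
Proof.
elim: s => [|i s IH]; first by rewrite !big_nil cn0.
by rewrite !big_cons; apply: le_trans (cnD _ _) _; rewrite lerD2l.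
Qed.

Lemma cn_small z : (forall e : R, 0 < e -> cn z <= e) -> z = 0.
Proof.
move=> H; apply: Normc.eq0_normc; apply/eqP; rewrite eq_le cn_ge0 andbT.
by apply/ler_addgt0Pl => e e0; rewrite addr0 H.
Qed.

End Modulus.

Section SubSums.
Variables (R : realType) (T : eqType).
Implicit Types (s t : seq T) (f : T -> R).

Lemma sum_subset f s t : (forall i, 0 <= f i) -> uniq s -> uniq t ->
  {subset s <= t} -> \sum_(i <- s) f i <= \sum_(i <- t) f i.
Proof.
move=> f0 us ut st.
have -> : \sum_(i <- s) f i = \sum_(i <- t | i \in s) f i.
  rewrite -[RHS]big_filter; apply: perm_big; apply: uniq_perm => //.
    exact: filter_uniq.
  move=> i; rewrite mem_filter; case: (boolP (i \in s)) => //= /st.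
  by move=> ->.
rewrite big_mkcond /=; apply: ler_sum => i _; case: ifP => //.
Qed.

End SubSums.

Section Tot.
Variables (R : realType) (T : eqType).
Implicit Types (s t : seq T) (a b : T -> R[i]) (f : T -> R).

(** Absolute summability with an explicit bound on all finite partial sums; lists without repetition
    stand for finite subsets, so the index type needs no order. *)
Definition summ_by a (M : R) :=
  forall s, uniq s -> \sum_(i <- s) cn (a i) <= M.

(** Convergence along the net of finite subsets. It is invariant under every bijection of the
    indices, as the changes of variables on pairs of integers below require. *)
Definition has_tot a (z : R[i]) := forall e : R, 0 < e ->
  exists s0, forall s, uniq s -> {subset s0 <= s} ->
    cn (\sum_(i <- s) a i - z) <= e.

(* Junk value: [tot a = 0] when [a] has no unconditional sum. *)
Definition tot a : R[i] := xget 0 [set z | has_tot a z].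

Lemma has_tot_uniq a z w : has_tot a z -> has_tot a w -> z = w.
Proof.
move=> az aw; apply/eqP; rewrite -subr_eq0; apply/eqP; apply: cn_small => e e0.
have e20 : 0 < e / 2 by rewrite divr_gt0.
have [s0 H0] := az _ e20; have [s1 H1] := aw _ e20.
pose s := undup (s0 ++ s1).
have us : uniq s by exact: undup_uniq.
have h0 : {subset s0 <= s} by move=> i; rewrite mem_undup mem_cat => ->.
have h1 : {subset s1 <= s}.
  by move=> i; rewrite mem_undup mem_cat => ->; rewrite orbT.
rewrite (splitr e); apply: le_trans (cn_dist (\sum_(i <- s) a i) _ _) _.
by rewrite lerD ?H1 // cnB H0.
Qed.

Lemma totE a z : has_tot a z -> tot a = z.
Proof.
move=> az; rewrite /tot; case: xgetP => [w -> /= aw|/(_ z)] //.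
exact: has_tot_uniq aw az.
Qed.

Lemma has_totR_ge0 f (M : R) : (forall i, 0 <= f i) ->
  (forall s, uniq s -> \sum_(i <- s) f i <= M) ->
  exists z : R, forall e : R, 0 < e -> exists s0, forall s, uniq s ->
    {subset s0 <= s} -> `|\sum_(i <- s) f i - z| <= e.
Proof.
move=> f0 fM; pose E := [set x : R | exists2 s, uniq s & x = \sum_(i <- s) f i].
have supE : has_sup E.
  split; first by exists 0, [::]; rewrite ?big_nil.
  by exists M => _ [s us ->]; exact: fM.
exists (sup E) => e e0.
have [_ [s0 us0 ->] s0e] := sup_adherent e0 supE.
exists s0 => s us s0s.
have h1 : \sum_(i <- s) f i <= sup E by apply: ub_le_sup; [case: supE|exists s].
have h2 := sum_subset f0 us0 us s0s.
rewrite ler_norml; apply/andP; split; lra.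
Qed.

(** [f] is the difference of the nonnegative families [|f| + f] and [|f|], whose sums are
    suprema. *)
Lemma has_totR f (M : R) :
  (forall s, uniq s -> \sum_(i <- s) `|f i| <= M) ->
  exists z : R, forall e : R, 0 < e -> exists s0, forall s, uniq s ->
    {subset s0 <= s} -> `|\sum_(i <- s) f i - z| <= e.
Proof.
move=> fM.
have [] := @has_totR_ge0 (fun i => `|f i|) M => [i||z1 H1]; first exact: normr_ge0.
  exact: fM.
have [] := @has_totR_ge0 (fun i => `|f i| + f i) (M + M) => [i|s us|z2 H2].
- by have := ler_norm (- f i); rewrite normrN; lra.
- rewrite big_split /= lerD ?fM //; apply: le_trans (fM _ us).
  by apply: ler_sum => i _; exact: ler_norm.
exists (z2 - z1) => e e0; have e20 : 0 < e / 2 by rewrite divr_gt0.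
have [s1 {}H1] := H1 _ e20; have [s2 {}H2] := H2 _ e20.
exists (s1 ++ s2) => s us ss.
have h1 : `|\sum_(i <- s) `|f i| - z1| <= e / 2.
  by apply: H1 => // i si; apply: ss; rewrite mem_cat si.
have h2 : `|\sum_(i <- s) (`|f i| + f i) - z2| <= e / 2.
  by apply: H2 => // i si; apply: ss; rewrite mem_cat si orbT.
move: h1 h2; rewrite big_split /= !ler_norml => /andP[h1 h1'] /andP[h2 h2'].
apply/andP; split; lra.
Qed.

Lemma summ_by_tot a M : summ_by a M -> has_tot a (tot a).
Proof.
move=> aM.
have [] := @has_totR (fun i => complex.Re (a i)) M => [s us|x Hx].
  by apply: le_trans (aM _ us); apply: ler_sum => i _; exact: cn_Re.
have [] := @has_totR (fun i => complex.Im (a i)) M => [s us|y Hy].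
  by apply: le_trans (aM _ us); apply: ler_sum => i _; exact: cn_Im.
suff h : has_tot a (x +i* y) by rewrite (totE h).
move=> e e0; have e20 : 0 < e / 2 by rewrite divr_gt0.
have [s1 {}Hx] := Hx _ e20; have [s2 {}Hy] := Hy _ e20.
exists (s1 ++ s2) => s us ss.
have h1 : `|\sum_(i <- s) complex.Re (a i) - x| <= e / 2.
  by apply: Hx => // i si; apply: ss; rewrite mem_cat si.
have h2 : `|\sum_(i <- s) complex.Im (a i) - y| <= e / 2.
  by apply: Hy => // i si; apply: ss; rewrite mem_cat si orbT.
apply: le_trans (cn_le _) _.
rewrite (splitr e) lerD //.
  rewrite (_ : complex.Re _ = \sum_(i <- s) complex.Re (a i) - x) //.
  elim: (s) => [|i s' IH]; first by rewrite !big_nil.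
  rewrite !big_cons -!addrA -IH.
  by case: (a i) => ? ?; case: (\sum_(j <- s') _).
rewrite (_ : complex.Im _ = \sum_(i <- s) complex.Im (a i) - y) //.
elim: (s) => [|i s' IH]; first by rewrite !big_nil.
rewrite !big_cons -!addrA -IH.
by case: (a i) => ? ?; case: (\sum_(j <- s') _).
Qed.

Lemma summ_by_tail a M : summ_by a M -> forall e : R, 0 < e -> exists s0,
  forall s, uniq s -> (forall i, i \in s -> i \notin s0) ->
    \sum_(i <- s) cn (a i) <= e.
Proof.
move=> aM e e0; have e20 : 0 < e / 2 by rewrite divr_gt0.
have [] := @has_totR_ge0 (fun i => cn (a i)) M => [i||z H]; first exact: cn_ge0.
  exact: aM.
have [s0 {}H] := H _ e20; exists s0 => s us dis.
have h1 : `|\sum_(i <- undup s0) cn (a i) - z| <= e / 2.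
  by apply: H; [exact: undup_uniq|move=> i; rewrite mem_undup].
have h2 : `|\sum_(i <- undup s0 ++ s) cn (a i) - z| <= e / 2.
  apply: H => [|i]; last by rewrite mem_cat mem_undup => ->.
  rewrite cat_uniq undup_uniq us andbT /=.
  by apply/hasPn => i /dis; rewrite mem_undup.
move: h1 h2; rewrite big_cat /= !ler_norml => /andP[h1 h1'] /andP[h2 h2'].
lra.
Qed.

Lemma summ_by_le a b M : (forall i, cn (a i) <= cn (b i)) -> summ_by b M ->
  summ_by a M.
Proof. by move=> ab bM s us; apply: le_trans (bM _ us); exact: ler_sum. Qed.

Lemma summ_by_le_const a b M (C : R) : (forall i, cn (a i) <= C * cn (b i)) ->
  0 <= C -> summ_by b M -> summ_by a (C * M).
Proof.
move=> ab C0 bM s us; apply: (@le_trans _ _ (\sum_(i <- s) C * cn (b i))).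
  exact: ler_sum.
by rewrite -mulr_sumr ler_wpM2l // bM.
Qed.

Lemma summ_by_ge0 a M : summ_by a M -> 0 <= M.
Proof. by move=> /(_ [::] isT); rewrite big_nil. Qed.

Lemma tot_norm a M : summ_by a M -> cn (tot a) <= M.
Proof.
move=> aM; have h := summ_by_tot aM.
apply/ler_addgt0Pl => e e0; have [s0 H] := h _ e0.
have {}H := H (undup s0) (undup_uniq _) (fun i => _).
have : cn (\sum_(i <- undup s0) a i - tot a) <= e.
  by apply: H => i; rewrite mem_undup.
have h2 : cn (\sum_(i <- undup s0) a i) <= M.
  exact: le_trans (cn_sum _ _) (aM _ (undup_uniq _)).
move=> h1; rewrite -[tot a](subrK (\sum_(i <- undup s0) a i)).
by apply: le_trans (cnD _ _) _; rewrite cnB lerD.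
Qed.

Lemma has_totD a b z w : has_tot a z -> has_tot b w ->
  has_tot (fun i => a i + b i) (z + w).
Proof.
move=> az bw e e0; have e20 : 0 < e / 2 by rewrite divr_gt0.
have [s1 H1] := az _ e20; have [s2 H2] := bw _ e20.
exists (s1 ++ s2) => s us ss; rewrite big_split /= opprD addrACA (splitr e).
apply: le_trans (cnD _ _) (lerD (H1 _ us _) (H2 _ us _)) => i si.
  by apply: ss; rewrite mem_cat si.
by apply: ss; rewrite mem_cat si orbT.
Qed.

Lemma has_totZ a z k : has_tot a z -> has_tot (fun i => k * a i) (k * z).
Proof.
move=> az e e0.
have k0 : 0 < cn k + 1 by rewrite ltr_wpDl ?cn_ge0.
have [s0 H] := az _ (divr_gt0 e0 k0).
exists s0 => s us ss; rewrite -mulr_sumr -mulrBr cnM.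
apply: le_trans (ler_wpM2l (cn_ge0 k) (H _ us ss)) _.
rewrite mulrA ler_pdivrMr // mulrC ler_wpM2l ?ltW //; lra.
Qed.

Lemma has_tot0 : has_tot (fun=> 0) 0.
Proof. by move=> e e0; exists [::] => s _ _; rewrite big1 // subrr cn0 ltW. Qed.

Lemma has_tot_sum (I : Type) (r : seq I) (a : I -> T -> R[i]) (z : I -> R[i]) :
  (forall j, has_tot (a j) (z j)) ->
  has_tot (fun i => \sum_(j <- r) a j i) (\sum_(j <- r) z j).
Proof.
move=> H; elim: r => [|j r IH].
  rewrite big_nil (_ : (fun _ => _) = (fun=> 0)); first exact: has_tot0.
  by apply/funext => i; rewrite big_nil.
rewrite big_cons (_ : (fun _ => _) = (fun i => a j i + \sum_(j <- r) a j i)).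
  exact: has_totD.
by apply/funext => i; rewrite big_cons.
Qed.

(** Dominated convergence: a finite set carries all but [e / 2] of the majorant, and on it only
    finitely many pointwise limits are taken. *)
Lemma tot_dominated (u : nat -> T -> R[i]) b M :
  (forall k i, cn (u k i) <= cn (b i)) -> summ_by b M ->
  (forall i (e : R), 0 < e -> exists k0, forall k, (k0 <= k)%N -> cn (u k i) <= e) ->
  forall e : R, 0 < e -> exists k0, forall k, (k0 <= k)%N -> cn (tot (u k)) <= e.
Proof.
move=> ub bM u0 e e0; have e20 : 0 < e / 2 by rewrite divr_gt0.
have [s0 tl] := summ_by_tail bM e20.
pose t0 := undup s0.
have [k0 Hk] : exists k0, forall k, (k0 <= k)%N ->
    \sum_(i <- t0) cn (u k i) <= e / 2.
  elim: t0 (e / 2) e20 => [|i t IH] d d0.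
    by exists 0%N => k _; rewrite big_nil ltW.
  have d20 : 0 < d / 2 by rewrite divr_gt0.
  have [k1 H1] := u0 i _ d20; have [k2 H2] := IH _ d20.
  exists (maxn k1 k2) => k; rewrite geq_max => /andP[h1 h2].
  by rewrite big_cons (splitr d) lerD ?H1 ?H2.
exists k0 => k kk0; apply: tot_norm => s us.
rewrite (bigID (mem t0)) /= (splitr e) lerD //.
  apply: le_trans (Hk _ kk0); rewrite -big_filter; apply: sum_subset.
  - by move=> i; exact: cn_ge0.
  - exact: filter_uniq.
  - exact: undup_uniq.
  - by move=> i; rewrite mem_filter => /andP[].
rewrite -big_filter; apply: (@le_trans _ _ (\sum_(i <- [seq i <- s | i \notin t0]) cn (b i))).
  by apply: ler_sum => i _.
apply: tl; first exact: filter_uniq.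
by move=> i; rewrite mem_filter mem_undup => /andP[].
Qed.

End Tot.

Section Reindex.
Variables (R : realType) (T U : eqType) (f : U -> T) (g : T -> U).
Hypotheses (fK : cancel f g) (gK : cancel g f).

Lemma has_tot_reindex (a : T -> R[i]) z : has_tot a z -> has_tot (a \o f) z.
Proof.
move=> az e e0; have [s0 H] := az _ e0.
exists (map g s0) => s us ss.
rewrite (_ : \sum_(i <- s) _ = \sum_(i <- map f s) a i); last by rewrite big_map.
apply: H; first by rewrite map_inj_uniq //; exact: can_inj fK.
by move=> i si; rewrite -(gK i) map_f // ss // map_f.
Qed.

Lemma summ_by_reindex (a : T -> R[i]) M : summ_by a M -> summ_by (a \o f) M.
Proof.
move=> aM s us; apply: le_trans (aM (map f s) _); first by rewrite big_map.
by rewrite map_inj_uniq //; exact: can_inj fK.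
Qed.

End Reindex.

Section Fubini.
Variables (R : realType) (T U : eqType).

Lemma summ_by_pair (a : T * U -> R[i]) (b : T -> R[i]) (M N : R) :
  (forall t, summ_by (fun u => a (t, u)) (cn (b t) * N)) ->
  summ_by b M -> 0 <= N -> summ_by a (M * N).
Proof.
move=> aN bM N0 s us.
pose s1 := undup (map fst s); pose s2 := undup (map snd s).
apply: (@le_trans _ _ (\sum_(p <- [seq (t, u) | t <- s1, u <- s2]) cn (a p))).
  apply: sum_subset => //.
  - by move=> i; exact: cn_ge0.
  - by rewrite allpairs_uniq ?undup_uniq // => -[x y] [x' y'].
  move=> [x y] xys; apply/allpairsP; exists (x, y); split=> //=.
    by rewrite mem_undup; apply/mapP; exists (x, y).
  by rewrite mem_undup; apply/mapP; exists (x, y).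
rewrite big_allpairs_dep /=.
apply: (@le_trans _ _ (\sum_(t <- s1) cn (b t) * N)).
  by apply: ler_sum => t _; apply: aN; exact: undup_uniq.
by rewrite -mulr_suml ler_wpM2r // bM // undup_uniq.
Qed.

Lemma has_tot_fubini (a : T * U -> R[i]) z :
  (forall t, exists M, summ_by (fun u => a (t, u)) M) -> has_tot a z ->
  has_tot (fun t => tot (fun u => a (t, u))) z.
Proof.
move=> aM az e e0; have e20 : 0 < e / 2 by rewrite divr_gt0.
have [s0 H] := az _ e20.
exists (map fst s0) => s us ss.
(* One finite [v] serves all the rows indexed by [s]: the rectangle of [s] and [v] contains [s0], so
   its sum is close to [z], and row by row it is close to the iterated sum. *)
have [v [uv sv Hv]] : exists v : seq U, [/\ uniq v, {subset map snd s0 <= v} &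
    cn (\sum_(t <- s) (\sum_(u <- v) a (t, u) - tot (fun u => a (t, u)))) <= e / 2].
  have [v0 Hv0] : exists v0 : seq U, forall v, uniq v -> {subset v0 <= v} ->
      cn (\sum_(t <- s) (\sum_(u <- v) a (t, u) - tot (fun u => a (t, u)))) <= e / 2.
    elim: (s) (e / 2) e20 => [|t s' IH] d d0.
      by exists [::] => v _ _; rewrite big_nil cn0 ltW.
    have d20 : 0 < d / 2 by rewrite divr_gt0.
    have [M tM] := aM t.
    have [v1 H1] := summ_by_tot tM d20; have [v2 H2] := IH _ d20.
    exists (v1 ++ v2) => v uv vv; rewrite big_cons (splitr d).
    apply: le_trans (cnD _ _) (lerD (H1 _ uv _) (H2 _ uv _)) => i si.
      by apply: vv; rewrite mem_cat si.
    by apply: vv; rewrite mem_cat si orbT.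
  exists (undup (v0 ++ map snd s0)); split; first exact: undup_uniq.
    by move=> u hu; rewrite mem_undup mem_cat hu orbT.
  apply: Hv0; first exact: undup_uniq.
  by move=> u hu; rewrite mem_undup mem_cat hu.
have := H [seq (t, u) | t <- s, u <- v]; rewrite big_allpairs_dep /=.
move=> /(_ _ _)/wrap[||h].
- by rewrite allpairs_uniq // => -[x y] [x' y'].
- move=> [x y] xys; apply/allpairsP; exists (x, y); split=> //=.
    by apply: ss; apply/mapP; exists (x, y).
  by apply: sv; apply/mapP; exists (x, y).
rewrite sumrB in Hv.
apply: le_trans (cn_dist (\sum_(t <- s) \sum_(u <- v) a (t, u)) _ _) _.
by rewrite (splitr e) lerD // cnB.
Qed.

Lemma tot_fubini (a : T * U -> R[i]) M : summ_by a M ->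
  tot (fun t => tot (fun u => a (t, u))) = tot a.
Proof.
move=> aM; apply: totE; apply: has_tot_fubini; last exact: summ_by_tot aM.
move=> t; exists M => s us; apply: le_trans (aM [seq (t, u) | u <- s] _).
  by rewrite big_map.
by rewrite map_inj_uniq // => u v [].
Qed.

End Fubini.

(** * Exponentials and the cardinal sine *)

Section Trig.
Variable R : realType.
Implicit Types (t u x y h : R) (l m : int).

Lemma expiD t u : expi (t + u) = expi t * expi u.
Proof.
rewrite /expi cosD sinD; simpc; congr (_ +i* _).
by rewrite addrC.
Qed.

Lemma expi0 : expi (0 : R) = 1.
Proof. by rewrite /expi cos0 sin0. Qed.

Lemma cn_expi t : cn (expi t) = 1.
Proof. by rewrite /= cos2Dsin2 sqrtr1. Qed.

Lemma expiN t : expi (- t) = conjc (expi t).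
Proof. by rewrite /expi cosN sinN. Qed.

Lemma expi_2pin (k : nat) : expi (2 * pi * k%:R : R) = 1.
Proof.
rewrite mulr_natr -[X in expi X]add0r /expi (_ : 2 * pi = pi *+ 2 :> R).
  by rewrite (periodicn (@cosD2pi R)) (periodicn (@sinD2pi R)) cos0 sin0.
by rewrite mulr2n mulrDl mul1r.
Qed.

Lemma expi_2pi m : expi (2 * pi * m%:~R : R) = 1.
Proof.
case: m => k; first exact: expi_2pin.
by rewrite NegzE mulrNz mulrN expiN expi_2pin conjc1.
Qed.

Definition ex l x : R[i] := expi (l%:~R * x).

Lemma exDl l m x : ex (l + m) x = ex l x * ex m x.
Proof. by rewrite /ex rmorphD mulrDl expiD. Qed.

Lemma exDr l x y : ex l (x + y) = ex l x * ex l y.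
Proof. by rewrite /ex mulrDr expiD. Qed.

Lemma ex0 x : ex 0 x = 1.
Proof. by rewrite /ex mul0r expi0. Qed.

Lemma exr0 l : ex l 0 = 1.
Proof. by rewrite /ex mulr0 expi0. Qed.

Lemma exN l x : ex (- l) x = ex l (- x).
Proof. by rewrite /ex mulrNz mulNr mulrN. Qed.

Lemma exJ l x : conjc (ex l x) = ex (- l) x.
Proof. by rewrite /ex mulrNz mulNr expiN. Qed.

Lemma exNK l x : ex (- l) x * ex l x = 1.
Proof. by rewrite -exDl addNr ex0. Qed.

Lemma cn_ex l x : cn (ex l x) = 1.
Proof. exact: cn_expi. Qed.

Lemma ex_2pi l x m : ex l (x + 2 * pi * m%:~R) = ex l x.
Proof.
by rewrite exDr /ex mulrCA -rmorphM expi_2pi mulr1.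
Qed.

Lemma exX (k : nat) x : ex k%:Z x = expi x ^+ k.
Proof.
elim: k => [|k IH]; first by rewrite ex0.
by rewrite exprS -IH intS exDl /ex mul1r.
Qed.

Lemma cos_ex l x y : ex l y * (cos (l%:~R * x))%:C =
  (ex l (y + x) + ex l (y - x)) / 2%:R.
Proof.
rewrite !exDr -mulrDr -mulrA; congr (_ * _).
by rewrite /ex mulrN expiN addcJ /= mulrAC divff ?mul1r.
Qed.

Lemma derive_bound (f df : R -> R) (C u : R) :
  (forall x, is_derive x 1 f (df x)) -> (forall x, `|x| <= `|u| -> `|df x| <= C) ->
  `|f u - f 0| <= C * `|u|.
Proof.
move=> fd dfC.
have cf (A : set R) : {within A, continuous f}.
  by apply: continuous_subspaceT => x; apply: differentiable_continuous;
    apply/derivable1_diffP; case: (fd x).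
have [u0|u0] := leP 0 u.
  have [c /[!in_itv] /= /andP[c0 cu] ->] := @MVT_segment R f df 0 u u0
    (fun x _ => fd x) (cf _).
  rewrite subr0 normrM ler_wpM2r // dfC //.
  by rewrite !ger0_norm.
have [c /[!in_itv] /= /andP[c0 cu] E] := @MVT_segment R f df u 0 (ltW u0)
  (fun x _ => fd x) (cf _).
rewrite distrC E sub0r normrM normrN ler_wpM2r // dfC //.
by rewrite !ler0_norm ?lerN2 // ltW.
Qed.

Lemma sin_le_norm u : `|sin u| <= `|u|.
Proof.
have := @derive_bound sin cos 1 u (fun x => is_derive_sin x).
by rewrite sin0 subr0 mul1r; apply => x _; exact: cos_max.
Qed.

Lemma one_sub_cos u : `|1 - cos u| <= u ^+ 2 / 2.
Proof.
have E : 1 - cos u = sin (u / 2) ^+ 2 * 2.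
  rewrite [in LHS](_ : u = (u / 2) *+ 2) ?cos_mulr2n; last first.
    by rewrite -mulr_natr divfK // pnatr_eq0.
  by rewrite sin2cos2 -mulr_natr; ring.
rewrite E normrM normrX (ger0_norm (ler0n _ _)).
have : `|sin (u / 2)| ^+ 2 <= `|u / 2| ^+ 2.
  by rewrite lerXn2r ?nnegrE // sin_le_norm.
rewrite (real_normK (num_real (u / 2))); lra.
Qed.

Lemma sin_sub_cube u : `|sin u - u| <= `|u| ^+ 3 / 2.
Proof.
have := @derive_bound (fun x => sin x - x) (fun x => cos x - 1) (u ^+ 2 / 2) u
  (fun x => is_deriveB (is_derive_sin x) (is_derive_id x 1)).
rewrite sin0 !subr0 => /(_ _)/wrap[x xu|h].
  rewrite distrC; apply: le_trans (one_sub_cos _) _.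
  rewrite ler_wpM2r // -(real_normK (num_real x)) -(real_normK (num_real u)).
  by rewrite lerXn2r ?nnegrE.
by apply: le_trans h _; rewrite (exprSr `|u| 2) real_normK ?num_real // mulrAC.
Qed.

Lemma sin_sub_sqr u : `|sin u - u| <= u ^+ 2.
Proof.
have [u2|u2] := leP `|u| 2.
  apply: le_trans (sin_sub_cube u) _; rewrite exprSr.
  rewrite -(real_normK (num_real u)); have := sqr_ge0 `|u|; nra.
apply: (@le_trans _ _ (`|u| + `|u|)).
  apply: le_trans (ler_normB _ _) _; by rewrite lerD2r sin_le_norm.
rewrite -(real_normK (num_real u)); nra.
Qed.

Lemma expi_taylor u : cn (expi u - 1 - (0 +i* u)) <= 2 * u ^+ 2.
Proof.
apply: le_trans (cn_le _) _; rewrite /expi /= !subr0.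
have := one_sub_cos u; have := sin_sub_sqr u; rewrite [`|1 - _|]distrC.
by have := sqr_ge0 u; lra.
Qed.

Definition sinc x := if x == 0 then 1 else sin x / x.

Lemma sinc0 : sinc 0 = 1.
Proof. by rewrite /sinc eqxx. Qed.

Lemma sincM x : sinc x * x = sin x.
Proof. by rewrite /sinc; case: eqP => [->|/eqP x0]; rewrite ?mulr0 ?sin0 ?divfK. Qed.

Lemma sinc_half x : sinc x = cos (x / 2) * sinc (x / 2).
Proof.
have [->|x0] := eqVneq x 0; first by rewrite mul0r sinc0 cos0 mulr1.
have x20 : x / 2 != 0 by rewrite mulf_neq0 // invr_eq0 pnatr_eq0.
apply: (mulIf x0); rewrite sincM -mulrA.
have -> : sinc (x / 2) * x = sin (x / 2) * 2.
  by rewrite -sincM -mulrA divfK // pnatr_eq0.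
have -> : sin x = sin (x / 2 *+ 2) by rewrite -mulr_natr divfK // pnatr_eq0.
by rewrite sin_mulr2n -mulr_natr mulrA.
Qed.

Lemma sinc_le1 x : `|sinc x| <= 1.
Proof.
rewrite /sinc; case: eqP => [_|/eqP x0]; first by rewrite normr1.
by rewrite normrM normfV ler_pdivrMr ?normr_gt0 // mul1r sin_le_norm.
Qed.

Lemma sinc_decay x : `|sinc x| * `|x| <= 1.
Proof. by rewrite -normrM sincM sin_max. Qed.

Lemma one_sub_sinc x : `|1 - sinc x| <= x ^+ 2 / 2.
Proof.
rewrite /sinc; case: eqP => [->|/eqP x0].
  by rewrite subrr normr0 expr0n mul0r.
have -> : 1 - sin x / x = (x - sin x) / x by field.
rewrite normrM normfV ler_pdivrMr ?normr_gt0 // distrC.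
apply: le_trans (sin_sub_cube x) _.
by rewrite exprSr real_normK ?num_real // mulrAC.
Qed.

Lemma sinc_ge_half x : `|x| <= 1 -> 1 / 2 <= sinc x.
Proof.
move=> x1; have := one_sub_sinc x; rewrite ler_norml => /andP[_].
have : x ^+ 2 <= 1 by rewrite -(real_normK (num_real x)) expr_le1.
lra.
Qed.

Lemma one_sub_sinc4 x : `|1 - sinc x ^+ 4| <= 2 * x ^+ 2.
Proof.
have -> : 1 - sinc x ^+ 4 = (1 - sinc x) * (1 + sinc x + sinc x ^+ 2 + sinc x ^+ 3).
  by ring.
rewrite normrM (_ : 2 * x ^+ 2 = x ^+ 2 / 2 * 4); last by field.
rewrite ler_pM // ?one_sub_sinc //.
have s1 := sinc_le1 x.
have s2 : `|sinc x| ^+ 2 <= 1 by rewrite expr_le1.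
have s3 : `|sinc x| ^+ 3 <= 1 by rewrite expr_le1.
apply: le_trans (ler_normD _ _) _; apply: le_trans (lerD (ler_normD _ _) (lexx _)) _.
apply: le_trans (lerD (lerD (ler_normD _ _) (lexx _)) (lexx _)) _.
rewrite normr1 !normrX; lra.
Qed.

End Trig.

(** * Sums over the integers *)

Definition zseq (N : nat) : seq int :=
  [seq j%:Z - N%:Z | j <- index_iota 0 (2 * N).+1].

Lemma mem_zseq N l : (l \in zseq N) = (`|l| <= N)%N.
Proof.
apply/mapP/idP => [[j]|lN].
  by rewrite mem_index_iota => jN ->; lia.
exists (absz (l + N%:Z)); last by lia.
by rewrite mem_index_iota; lia.
Qed.

Lemma uniq_zseq N : uniq (zseq N).
Proof. by rewrite map_inj_uniq ?iota_uniq // => i j; lia. Qed.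

Lemma zseq_exhaust (s : seq int) : exists N, {subset s <= zseq N}.
Proof.
elim: s => [|l s [N sN]]; first by exists 0%N.
exists (maxn `|l| N) => i; rewrite in_cons mem_zseq leq_max => /orP[/eqP ->|/sN].
  by rewrite leqnn.
by rewrite mem_zseq => ->; rewrite orbT.
Qed.

Lemma zseqS N : @perm_eq (int : eqType) (zseq N.+1) [:: N.+1%:Z, - N.+1%:Z & zseq N].
Proof.
apply: uniq_perm; first exact: uniq_zseq.
  rewrite !cons_uniq; apply/and3P; split; last exact: uniq_zseq.
    by rewrite in_cons mem_zseq; lia.
  by rewrite mem_zseq; lia.
by move=> l; rewrite mem_zseq 2!in_cons mem_zseq; lia.
Qed.

Lemma zseq_ind (V : nmodType) N (f : int -> V) : \sum_(l <- zseq N.+1) f l =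
  f N.+1%:Z + (f (- N.+1%:Z) + \sum_(l <- zseq N) f l).
Proof. by rewrite (perm_big _ (zseqS N)) /= !big_cons. Qed.

Section IntSums.
Variable R : realType.
Implicit Types (a b : int -> R[i]) (w : int -> R).

Lemma has_tot_zseq a z : has_tot a z -> forall e : R, 0 < e ->
  exists N, forall L, (N <= L)%N -> cn (\sum_(l <- zseq L) a l - z) <= e.
Proof.
move=> az e e0; have [s0 H] := az _ e0; have [N sN] := zseq_exhaust s0.
exists N => L NL; apply: H; first exact: uniq_zseq.
by move=> l /sN; rewrite !mem_zseq => /leq_trans; apply.
Qed.

Lemma has_tot_finite a s : uniq s -> (forall l, l \notin s -> a l = 0) ->
  has_tot a (\sum_(l <- s) a l).
Proof.
move=> us as0 e e0; exists s => t ut st.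
rewrite (bigID (mem s)) /= [X in _ + X - _]big1; last by move=> l /as0.
rewrite addr0 -big_filter (perm_big s) ?subrr ?cn0 ?ltW //.
apply: uniq_perm => //; first exact: filter_uniq.
by move=> l; rewrite mem_filter; case: (boolP (l \in s)) => // /st ->.
Qed.

Lemma sum_zseq_le w s M : (forall l, 0 <= w l) ->
  (forall N, \sum_(l <- zseq N) w l <= M) -> uniq s -> \sum_(l <- s) w l <= M.
Proof.
move=> w0 wM us; have [N sN] := zseq_exhaust s.
exact: le_trans (sum_subset w0 us (uniq_zseq N) sN) (wM N).
Qed.

(** The weight of test functions. Shifting a symmetric partial sum by [l] costs [O(|l|)] boundary
    terms, and submultiplicativity keeps the class stable under products. *)
Definition wt (l : int) : R := (1 + (absz l)%:R).

Lemma wt_ge1 l : 1 <= wt l. Proof. by rewrite /wt lerDl. Qed.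

Lemma wt_gt0 l : 0 < wt l. Proof. exact: lt_le_trans ltr01 (wt_ge1 l). Qed.

Lemma wtM l m : wt (l + m) <= wt l * wt m.
Proof.
rewrite /wt; have : (absz (l + m)%R)%:R <= (absz l)%:R + (absz m)%:R :> R.
  by rewrite -natrD ler_nat; lia.
have := ler0n R (absz l); have := ler0n R (absz m); nra.
Qed.

Lemma wtN l : wt (- l) = wt l. Proof. by rewrite /wt abszN. Qed.

(** The subtracted term makes the induction telescope, through
    [1 / (1 + x)^2 <= 1 / x - 1 / (1 + x)]. *)
Lemma sum_inv_wt N : \sum_(l <- zseq N) (wt l ^+ 2)^-1 <= 3 - 2 / N.+1%:R.
Proof.
elim: N => [|N IH].
  rewrite (_ : zseq 0 = [:: 0]) // big_seq1 /wt addr0 expr1n invr1; lra.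
rewrite zseq_ind wtN /wt /= addrA.
apply: le_trans (lerD (lexx _) IH) _.
set x : R := N.+1%:R; have x0 : 1 <= x by rewrite ler1n.
have -> : N.+2%:R = 1 + x by rewrite -natr1 addrC.
have h : ((1 + x) ^+ 2)^-1 <= x^-1 - (1 + x)^-1.
  have -> : x^-1 - (1 + x)^-1 = (x * (1 + x))^-1 by field; rewrite !gt_eqF //; lra.
  rewrite lef_pV2 ?posrE; first by nra.
    by rewrite exprn_gt0 //; lra.
  by rewrite mulr_gt0 //; lra.
move: h; move: x^-1 (1 + x)^-1 ((1 + x) ^+ 2)^-1 => u v w; lra.
Qed.

Lemma summ_by_inv_wt : summ_by (fun l => ((wt l ^+ 2)^-1)%:C) 3.
Proof.
move=> s us; have w0 l : 0 <= (wt l ^+ 2)^-1 by rewrite invr_ge0 exprn_ge0 // ltW ?wt_gt0.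
under eq_bigr => l _ do rewrite cn_real ger0_norm //.
apply: sum_zseq_le => // N; apply: le_trans (sum_inv_wt N) _.
by rewrite gerBl divr_ge0.
Qed.

(** Fourier coefficients of the fourth convolution power of the uniform law on [[-h, h]], a cubic
    B-spline. The even power makes them nonnegative. *)
Definition spl (h : R) (l : int) : R := sinc (l%:~R * h) ^+ 4.

Lemma spl_ge0 h l : 0 <= spl h l.
Proof. by rewrite /spl (exprM _ 2 2) sqr_ge0. Qed.

Lemma spl_le1 h l : spl h l <= 1.
Proof.
rewrite -(ger0_norm (spl_ge0 h l)) /spl normrX expr_le1 //; exact: sinc_le1.
Qed.

Lemma spl_decay h l : spl h l * (`|l%:~R| * `|h|) ^+ 4 <= 1.
Proof.
rewrite -(ger0_norm (spl_ge0 h l)) /spl normrX -exprMn expr_le1 //.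
by rewrite -normrM sinc_decay.
Qed.

Lemma summ_by_wspl h : 0 < h -> exists M, summ_by (fun l => (wt l * spl h l)%:C) M.
Proof.
move=> h0; exists ((1 + 8 * (h ^+ 4)^-1) * 3).
have h40 : 0 < h ^+ 4 by rewrite exprn_gt0.
apply: (summ_by_le_const _ _ summ_by_inv_wt); last first.
  by rewrite addr_ge0 // mulr_ge0 // invr_ge0 ltW.
move=> l; have w0 := wt_gt0 l; have s0 := spl_ge0 h l.
have w20 : 0 < wt l ^+ 2 by rewrite exprn_gt0.
rewrite !cn_real ger0_norm; last by rewrite mulr_ge0 // ltW.
rewrite ger0_norm; last by rewrite invr_ge0 ltW.
rewrite ler_pdivlMr //.
have -> : wt l * spl h l * wt l ^+ 2 = wt l ^+ 3 * spl h l by ring.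
have [->|l0] := eqVneq l 0.
  rewrite /wt /= addr0 expr1n mul1r; apply: le_trans (spl_le1 _ _) _.
  by rewrite lerDl mulr_ge0 // invr_ge0 ltW.
have := spl_decay h l; rewrite -intr_norm (gtr0_norm h0) exprMn.
have -> : (`|l|%R%:~R = (absz l)%:R :> R) by rewrite natr_absz.
rewrite /wt; set x : R := (absz l)%:R => H.
have x1 : 1 <= x by rewrite ler1n; lia.
have : spl h l * x ^+ 4 <= (h ^+ 4)^-1.
  by rewrite -[leRHS]mul1r ler_pdivlMr // -mulrA.
have : (1 + x) ^+ 3 <= 8 * x ^+ 4.
  have : (1 + x) ^+ 3 <= (x + x) ^+ 3 by rewrite lerXn2r ?nnegrE ?lerD2r //; lra.
  have : x ^+ 3 <= x ^+ 4 by rewrite (exprSr _ 3) ler_peMr // exprn_ge0 //; lra.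
  have -> : (x + x) ^+ 3 = 8 * x ^+ 3 by ring.
  lra.
move=> hx hs; apply: (@le_trans _ _ (8 * (spl h l * x ^+ 4))).
  by have := ler_wpM2r s0 hx; lra.
lra.
Qed.

End IntSums.

(** * Support of the B-spline *)

Section Spline.
Variable R : realType.
Implicit Types (t h d : R) (b : int -> R).

Definition far d t := forall m : int, d <= `|t - 2 * pi * m%:~R|.

Lemma far_shift d u t : far (d + `|u|) t -> far d (t + u).
Proof.
move=> H m; have := H m; have := ler_normD (t + u - 2 * pi * m%:~R) (- u).
rewrite normrN (_ : t + u - 2 * pi * m%:~R + - u = t - 2 * pi * m%:~R); last by ring.
lra.
Qed.

Lemma near_2pi t : exists m : int, `|t - 2 * pi * m%:~R| <= pi.
Proof.
have p0 : 0 < 2 * pi :> R by rewrite mulr_gt0 // pi_gt0.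
exists (Num.floor ((t + pi) / (2 * pi))).
have /andP[] := mem_rg1_floor ((t + pi) / (2 * pi)).
rewrite ler_pdivlMr // ltr_pdivrMr // => h1 h2.
rewrite ler_norml; lra.
Qed.

Lemma expi_far d : 0 < d -> exists2 c : R, 0 < c &
  forall t, far d t -> c <= cn (1 - expi t).
Proof.
move=> d0; have [dpi|dpi] := leP d pi; last first.
  (* Vacuous case: no real number is farther than [pi] from the multiples of [2 pi]. *)
  exists 1 => // t ft; have [m hm] := near_2pi t.
  by have := le_trans (ft m) hm; rewrite leNgt dpi.
exists (1 - cos d).
  have : cos d < cos 0 by rewrite ltr_cos ?in_itv /= ?lexx ?pi_ge0 ?dpi ?ltW.
  by rewrite cos0; lra.
move=> t ft; have [m hm] := near_2pi t; have dm := ft m.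
set u := t - 2 * pi * m%:~R in hm dm.
have tu : cos t = cos `|u|.
  rewrite cos_norm; have -> : cos u = complex.Re (ex 1 u) by rewrite /ex mul1r.
  rewrite (_ : u = t + 2 * pi * (- m)%:~R) ?ex_2pi ?/ex ?mul1r //.
  by rewrite /u rmorphN mulrN.
have cud : cos `|u| <= cos d.
  rewrite leNgt ltr_cos -?leNgt // in_itv /= ?hm ?normr_ge0 //.
  by rewrite ltW.
apply: le_trans (cn_Re _); apply: le_trans (ler_norm _).
by rewrite /= tu; lra.
Qed.

(** A difference [l] of two indices below [N] occurs [N - |l|] times. In the induction, the new row
    and column together run once through [zseq N]. *)
Lemma fejer_sum (V : zmodType) (f : int -> V) N :
  \sum_(r < N) \sum_(q < N) f (r%:Z - q%:Z) =
  \sum_(l <- zseq N) f l *+ (N - `|l|).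
Proof.
elim: N => [|N IH]; first by rewrite big_ord0 (_ : zseq 0 = [:: 0]) // big_seq1.
have E : \sum_(l <- zseq N) f l *+ (N.+1 - `|l|) =
    \sum_(l <- zseq N) f l *+ (N - `|l|) + \sum_(l <- zseq N) f l.
  rewrite -big_split /= big_seq [RHS]big_seq; apply: eq_bigr => l.
  by rewrite mem_zseq => lN; rewrite subSn // mulrSr.
rewrite zseq_ind abszN subnn !mulr0n !add0r E -IH big_ord_recr /=.
under eq_bigr => r _ do rewrite big_ord_recr /=.
rewrite big_split /= -addrA; congr (_ + _).
elim: (N) => [|M IHM].
  by rewrite big_ord0 add0r big_ord_recl big_ord0 addr0 (_ : zseq 0 = [:: 0]) // big_seq1.
rewrite zseq_ind -IHM big_ord_recl big_ord_recl /=.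
have E1 i : (bump 0 i)%:Z - M.+1%:Z = i%:Z - M%:Z by rewrite /bump; lia.
have E2 i : M.+1%:Z - (bump 0 i)%:Z = M%:Z - i%:Z by rewrite /bump; lia.
under eq_bigr => r _ do rewrite E1.
under [X in _ + (_ + X) = _]eq_bigr => r _ do rewrite E2.
by rewrite sub0r subr0 addrACA [_ + f M.+1%:Z]addrC -!addrA.
Qed.

(** [N] times a Cesaro mean. Without normalization, its values off the support stay bounded in [N],
    whereas for summable weighted coefficients it is [N] times the full sum up to a bounded error;
    hence that sum is zero off the support. *)
Definition fejer N b t : R[i] :=
  \sum_(l <- zseq N) ((b l)%:C * ex l t) *+ (N - `|l|).

(** Multiplying the coefficients by a cosine averages two translates of the function, so the support
    grows by [h] only. *)
Lemma fejer_cos N b h t :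
  fejer N (fun l => b l * cos (l%:~R * h)) t =
  (fejer N b (t + h) + fejer N b (t - h)) / 2%:R.
Proof.
rewrite /fejer -big_split /= mulr_suml; apply: eq_bigr => l _.
rewrite -mulrnDl -mulrDr mulrnAl -mulrA -cos_ex rmorphM; congr (_ *+ _).
by rewrite -mulrA [ex _ _ * _]mulrC.
Qed.

(** The Fejer kernel is a product of two geometric sums, each at most [2 / |1 - e^{it}|]. *)
Lemma fejer1 d : 0 < d -> exists M : R, forall N t, far d t ->
  cn (fejer N (fun=> 1) t) <= M.
Proof.
move=> d0; have [c c0 Hc] := expi_far d0; exists ((2 / c) * (2 / c)) => N t ft.
have -> : fejer N (fun=> 1) t =
    (\sum_(r < N) expi t ^+ r) * (\sum_(q < N) expi (- t) ^+ q).
  rewrite /fejer -fejer_sum mulr_suml; apply: eq_bigr => r _.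
  rewrite mulr_sumr; apply: eq_bigr => q _.
  by rewrite mul1r exDl exN !exX.
have geo u : c <= cn (1 - expi u) -> cn (\sum_(r < N) expi u ^+ r) <= 2 / c.
  move=> cu; have : cn ((1 - expi u) * \sum_(r < N) expi u ^+ r) <= 2.
    rewrite -opprB mulNr -subrX1 opprB; apply: le_trans (cn_triB _ _) _.
    by rewrite Normc.normc1 -exX cn_ex.
  rewrite cnM ler_pdivlMr // mulrC => /(le_trans _); apply.
  by rewrite ler_wpM2l ?cn_ge0.
rewrite cnM ler_pM ?cn_ge0 ?geo ?Hc // => m.
by have := ft (- m); rewrite -normrN opprB rmorphN mulrN addrC.
Qed.

Lemma spl_half h l :
  spl h l = spl (h / 2) l * cos (l%:~R * (h / 2)) * cos (l%:~R * (h / 2))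
     * cos (l%:~R * (h / 2)) * cos (l%:~R * (h / 2)).
Proof. by rewrite /spl sinc_half !mulrA; ring. Qed.

(* [cpow m h l] is [spl h l / spl (h / 2 ^ m) l], the Fourier transform of a
   discrete measure carried by [-4 h, 4 h]. *)
Fixpoint cpow (m : nat) h (l : int) : R :=
  if m is m'.+1 then
    cpow m' (h / 2) l * cos (l%:~R * (h / 2)) * cos (l%:~R * (h / 2))
     * cos (l%:~R * (h / 2)) * cos (l%:~R * (h / 2))
  else 1.

(** Four translations by [h / 2] use up [2 h], and the factor at scale [h / 2] uses up
    [4 (h / 2) = 2 h]; together they make the [4 h] of the hypothesis. *)
Lemma fejer_cpow d (M : R) N : (forall t, far d t -> cn (fejer N (fun=> 1) t) <= M) ->
  forall m h t, 0 <= h -> far (d + 4 * h) t -> cn (fejer N (cpow m h) t) <= M.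
Proof.
move=> HM; have step b u d' : 0 <= u ->
    (forall t, far d' t -> cn (fejer N b t) <= M) -> forall t, far (d' + u) t ->
    cn (fejer N (fun l => b l * cos (l%:~R * u)) t) <= M.
  move=> u0 H t ft; rewrite fejer_cos.
  have -> : 2%:R^-1 = (2^-1 : R)%:C by rewrite rmorphV ?unitfE ?pnatr_eq0 //= rmorph_nat.
  rewrite cnM cn_real gtr0_norm // ler_pdivrMr // mulr_natr mulr2n.
  apply: le_trans (cnD _ _) (lerD (H _ _) (H _ _)).
    by apply: far_shift; rewrite ger0_norm.
  by apply: far_shift; rewrite normrN ger0_norm.
elim=> [|m IH] h t h0 ft.
  by apply: HM => k; apply: le_trans (ft k); rewrite lerDl mulr_ge0.
have h20 : 0 <= h / 2 by rewrite divr_ge0.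
have -> : cpow m.+1 h = (fun l => cpow m (h / 2) l * cos (l%:~R * (h / 2)) * cos (l%:~R * (h / 2))
     * cos (l%:~R * (h / 2)) * cos (l%:~R * (h / 2))) by [].
have H := step _ _ _ h20 (step _ _ _ h20 (step _ _ _ h20 (step _ _ _ h20 (fun t => IH (h / 2) t h20)))).
by apply: H => k; apply: le_trans (ft k); lra.
Qed.

Lemma cpow_norm m h l : `|cpow m h l| <= 1.
Proof.
elim: m h => [|m IH] h /=; first by rewrite normr1.
rewrite !normrM; do 4! rewrite mulr_ile1 ?mulr_ge0 ?cos_max //.
Qed.

Lemma spl_cpow m h l : spl h l = cpow m h l * spl (h / 2 ^+ m) l.
Proof.
elim: m h => [|m IH] h /=; first by rewrite expr0 divr1 mul1r.
rewrite spl_half (IH (h / 2)) (_ : h / 2 ^+ m.+1 = h / 2 / 2 ^+ m); first by ring.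
by rewrite exprS invfM mulrA.
Qed.

(** What [cpow] misses is the factor [spl (h / 2 ^ m)], which is within [2 (N h / 2 ^ m)^2] of [1]
    for [|l| <= N]. *)
Lemma cpow_cvg h (N : nat) e : 0 < e -> exists m, forall l, (`|l| <= N)%N ->
  `|spl h l - cpow m h l| <= e.
Proof.
move=> e0; pose C := 2 * (N%:R * h) ^+ 2.
have C0 : 0 <= C by rewrite mulr_ge0 // sqr_ge0.
exists (Num.truncn (C / e)).+1 => l lN; set m := (Num.truncn _).+1.
rewrite (spl_cpow m) -[X in _ - X]mulr1 -mulrBr normrM -[e]mul1r.
apply: ler_pM; rewrite ?cpow_norm // distrC.
apply: le_trans (one_sub_sinc4 _) _.
have -> : l%:~R * (h / 2 ^+ m) = l%:~R * h / 2 ^+ m by rewrite mulrA.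
rewrite [X in 2 * X]exprMn mulrA exprVn.
have hm : C / e < m%:R by apply: truncnS_gt; rewrite ?divr_ge0 ?ltW // num_real.
have m0 : 0 < m%:R :> R by rewrite ltr0n.
have p0 : 0 < 2 ^+ m :> R by rewrite exprn_gt0.
have hC : 2 * (l%:~R * h) ^+ 2 <= C.
  rewrite ler_pM2l // -(real_normK (num_real (l%:~R * h))) -(real_normK (num_real (N%:R * h))).
  rewrite lerXn2r ?nnegrE // !normrM ler_wpM2r // -intr_norm normr_nat.
  have -> : (`|l|%R%:~R = (absz l)%:R :> R) by rewrite natr_absz.
  by rewrite ler_nat.
have hp : m%:R <= (2 ^+ m) ^+ 2 :> R.
  rewrite -natrX -natrX ler_nat; have := ltn_expl m (isT : (1 < 2)%N); nia.
rewrite ler_pdivrMr ?exprn_gt0 //.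
apply: le_trans hC _; rewrite ltr_pdivrMr // in hm.
by apply: le_trans (ltW hm) _; rewrite mulrC ler_wpM2l // ltW.
Qed.

(** The bound for [cpow m h] does not depend on [m], and for fixed [N] only finitely many
    coefficients pass to the limit. *)
Lemma fejer_spl d : 0 < d -> exists M : R, forall N h t, 0 <= h ->
  far (d + 4 * h) t -> cn (fejer N (spl h) t) <= M.
Proof.
move=> d0; have [M HM] := fejer1 d0; exists M => N h t h0 ft.
apply/ler_addgt0Pr => e e0.
pose K : R := \sum_(l <- zseq N) N%:R.
have K0 : 0 <= K by apply: sumr_ge0.
have K1 : 0 < K + 1 by rewrite ltr_wpDl.
have [m Hm] := cpow_cvg h N (divr_gt0 e0 K1).
rewrite -[fejer _ _ _](subrK (fejer N (cpow m h) t)) addrC.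
apply: le_trans (cnD _ _) (lerD (fejer_cpow (HM N) m h0 ft) _).
rewrite /fejer -sumrB; apply: le_trans (cn_sum _ _) _.
apply: (@le_trans _ _ (\sum_(l <- zseq N) N%:R * (e / (K + 1)))).
  rewrite big_seq [leRHS]big_seq; apply: ler_sum => l; rewrite mem_zseq => lN.
  rewrite -mulrnBl -mulrBl -rmorphB normcMn cnM cn_ex mulr1 cn_real -[_ *+ (N - _)]mulr_natl.
  by rewrite ler_pM // ?Hm // ler_nat leq_subr.
rewrite -mulr_suml mulrA ler_pdivrMr // mulrC ler_wpM2l //; last by rewrite lerDl.
exact: ltW.
Qed.

(* The function with Fourier coefficients [spl h] is supported in
   [-4 h, 4 h] modulo [2 pi]. *)
Lemma spline_support h d t : 0 < h -> 0 < d -> far (d + 4 * h) t ->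
  tot (fun l => (spl h l)%:C * ex l t) = 0.
Proof.
move=> h0 d0 ft; have [M HM] := fejer_spl d0.
have [W HW] := summ_by_wspl h0.
set a := fun l => _; set z := tot a.
have aW : has_tot a z.
  apply: (@summ_by_tot _ _ _ W); apply: summ_by_le HW => l.
  rewrite /a cnM cn_ex mulr1 !cn_real [`|wt _ _ * _|]normrM (gtr0_norm (wt_gt0 R l)).
  by rewrite ler_peMl // wt_ge1.
(* The coefficients of [N z] and of the Fejer sum differ by [min(N, |l|)] times those of the series,
   which the weight [wt] dominates; thus [N |z|] is bounded uniformly in [N]. *)
have key N : N%:R * cn z <= W + M.
  have h1 : has_tot (fun l => N%:R * a l - a l *+ (N - `|l|)) (N%:R * z - fejer N (spl h) t).
    apply: has_totD; first exact: has_totZ.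
    rewrite -[X in has_tot _ X]mulN1r.
    under eq_fun do rewrite -mulN1r.
    apply: has_totZ; apply: has_tot_finite; first exact: uniq_zseq.
    move=> l; rewrite mem_zseq -ltnNge => /ltnW /eqP; rewrite -/(subn _ _) => /eqP Nl.
    by rewrite (eqP Nl) mulr0n.
  have h2 : summ_by (fun l => N%:R * a l - a l *+ (N - `|l|)) W.
    apply: summ_by_le HW => l.
    rewrite mulr_natl -mulrnBr ?leq_subr // normcMn /a cnM cn_ex mulr1 !cn_real.
    rewrite [`|wt _ _ * _|]normrM (gtr0_norm (wt_gt0 R l)) -[_ *+ (N - _)]mulr_natl ler_wpM2r // /wt.
    apply: (@le_trans _ _ (absz l)%:R); last by rewrite lerDr.
    by rewrite ler_nat; lia.
  have := tot_norm h2; rewrite (totE h1) => h3.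
  have -> : N%:R * cn z = cn (N%:R * z).
    by rewrite cnM; congr (_ * _); rewrite -[N%:R in RHS]/(1 *+ N) normcMn Normc.normc1.
  rewrite -[N%:R * z](subrK (fejer N (spl h) t)).
  by apply: le_trans (cnD _ _) (lerD h3 _); apply: HM => //; exact: ltW.
apply: cn_small => e e0; rewrite leNgt; apply/negP => ez.
pose N := (Num.truncn ((W + M) / e)).+1.
have hN : (W + M) / e < N%:R by apply: truncnS_gt; rewrite num_real.
have := key N; rewrite leNgt => /negP; apply.
rewrite ltr_pdivrMr // in hN; apply: lt_trans hN _.
by rewrite ltr_pM2l // ltr0n.
Qed.

End Spline.

(** * Test functions *)

Section SumExtra.
Variables (R : realType) (T U : eqType).

Lemma summ_by_fubini (a : T * U -> R[i]) M : summ_by a M ->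
  summ_by (fun t => tot (fun u => a (t, u))) M.
Proof.
move=> aM s us; apply/ler_addgt0Pr => e e0.
have row t : summ_by (fun u => a (t, u)) M.
  move=> v uv; apply: le_trans (aM [seq (t, u) | u <- v] _).
    by rewrite big_map.
  by rewrite map_inj_uniq // => u w [].
have [v0 Hv0] : exists v0 : seq U, forall v, uniq v -> {subset v0 <= v} ->
    \sum_(t <- s) cn (tot (fun u => a (t, u))) <=
    \sum_(t <- s) \sum_(u <- v) cn (a (t, u)) + e.
  elim: (s) (e) e0 => [|t s' IH] d d0.
    by exists [::] => v _ _; rewrite !big_nil add0r ltW.
  have d20 : 0 < d / 2 by rewrite divr_gt0.
  have [v1 H1] := summ_by_tot (row t) d20; have [v2 H2] := IH _ d20.
  exists (v1 ++ v2) => v uv vv; rewrite !big_cons (splitr d) addrACA.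
  apply: lerD; last by apply: H2 => // i si; apply: vv; rewrite mem_cat si orbT.
  have {}H1 : cn (\sum_(u <- v) a (t, u) - tot (fun u => a (t, u))) <= d / 2.
    by apply: H1 => // i si; apply: vv; rewrite mem_cat si.
  rewrite -[tot _](subrK (\sum_(u <- v) a (t, u))) addrC.
  by apply: le_trans (cnD _ _) (lerD _ (cn_sum _ _)); rewrite cnB.
apply: le_trans (Hv0 (undup v0) (undup_uniq _) _) _.
  by move=> u; rewrite mem_undup.
rewrite lerD2r; have := aM [seq (t, u) | t <- s, u <- undup v0].
rewrite big_allpairs_dep /=; apply.
by rewrite allpairs_uniq ?undup_uniq // => -[x y] [x' y'].
Qed.

Lemma totZ (a : T -> R[i]) M k : summ_by a M ->
  tot (fun i => k * a i) = k * tot a.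
Proof. by move=> aM; apply: totE; apply: has_totZ; exact: summ_by_tot aM. Qed.

Lemma summ_byM (a : T -> R[i]) (b : U -> R[i]) (M N : R) :
  summ_by a M -> summ_by b N -> summ_by (fun p => a p.1 * b p.2) (M * N).
Proof.
move=> aM bN; apply: (summ_by_pair _ aM (summ_by_ge0 bN)) => t.
by apply: summ_by_le_const bN; rewrite ?cn_ge0 // => u; rewrite cnM.
Qed.

End SumExtra.

Section Swap.
Variables (R : realType) (T U : eqType).

Lemma tot_swap (a : T * U -> R[i]) M : summ_by a M ->
  tot (fun t => tot (fun u => a (t, u))) = tot (fun u => tot (fun t => a (t, u))).
Proof.
move=> aM; pose f (p : U * T) := (p.2, p.1); pose g (p : T * U) := (p.2, p.1).
have fK : cancel f g by case.
have gK : cancel g f by case.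
have aM' : summ_by (a \o f) M by exact: (summ_by_reindex fK aM).
rewrite (tot_fubini aM); transitivity (tot (a \o f)).
  by apply/esym/totE; exact: (has_tot_reindex fK gK (summ_by_tot aM)).
by rewrite -(tot_fubini aM').
Qed.

End Swap.

Section TestFunctions.
Variable R : realType.
Implicit Types (psi phi chi b c : int -> R[i]) (x t r : R).

(* A test function [t |-> \sum_j psi_j e^{-ijt}] is given by its coefficients. *)
Definition test psi := exists M, summ_by (fun l => (wt R l)%:C * psi l) M.

Definition tval psi t := tot (fun j => psi j * ex j (- t)).

(** With the sign chosen in [tval], this is the normalized integral of the distribution against the
    test function, without conjugate or reflection. *)
Definition pairing c psi := tot (fun l => c l * psi l).

(** Fourier coefficients of the product of the distribution by the test function: [e^{ilx} e^{-ijx}]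
    has frequency [m = l - j]. *)
Definition mulF psi c (m : int) := tot (fun j => psi j * c (m + j)).

Definition conv phi chi (l : int) := tot (fun j => phi j * chi (l - j)).

Lemma test_summ psi : test psi -> exists M, summ_by psi M.
Proof.
move=> [M H]; exists M; apply: summ_by_le H => l.
rewrite cnM cn_real gtr0_norm ?wt_gt0 //.
by rewrite ler_peMl ?cn_ge0 ?wt_ge1.
Qed.

Lemma summ_bounded psi b M B : (forall l, cn (b l) <= B) -> summ_by psi M ->
  summ_by (fun l => psi l * b l) (B * M).
Proof.
move=> bB pM; apply: summ_by_le_const pM; last exact: le_trans (cn_ge0 _) (bB 0).
by move=> l; rewrite cnM mulrC ler_wpM2r // cn_ge0.
Qed.

Let shear (p : int * int) : int * int := (p.2, p.1 - p.2).
Let unshear (p : int * int) : int * int := (p.1 + p.2, p.1).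

Let shearK : cancel shear unshear.
Proof. by case=> l j; rewrite /shear /unshear /= addrC subrK. Qed.

Let unshearK : cancel unshear shear.
Proof. by case=> j m; rewrite /shear /unshear /= addrAC subrr add0r. Qed.

Lemma test_conv phi chi : test phi -> test chi -> test (conv phi chi).
Proof.
move=> [M HM] [N HN]; exists (M * N).
have H := summ_by_reindex shearK (summ_byM HM HN).
have {}H : summ_by (fun p : int * int => (wt R p.1)%:C * (phi p.2 * chi (p.1 - p.2))) (M * N).
  apply: summ_by_le H => -[l j] /=.
  rewrite !cnM !cn_real !gtr0_norm ?wt_gt0 // mulrACA.
  rewrite ler_wpM2r ?mulr_ge0 ?cn_ge0 //.
  by apply: le_trans (wtM R j (l - j)); rewrite addrC subrK.
have := summ_by_fubini H.
congr (summ_by _ _); apply/funext => l /=; apply: (@totZ _ _ _ (M * N)).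
move=> s us; apply: le_trans (H [seq (l, j) | j <- s] _).
  rewrite big_map; apply: ler_sum => j _ /=.
  rewrite cnM [leRHS]cnM cn_real gtr0_norm ?wt_gt0 //.
  by rewrite -cnM ler_peMl ?cn_ge0 ?wt_ge1.
by rewrite map_inj_uniq // => u w [].
Qed.

Lemma tot_conv phi chi b B : test phi -> test chi -> (forall l, cn (b l) <= B) ->
  tot (fun l => b l * conv phi chi l) =
  tot (fun j => phi j * tot (fun m => chi m * b (j + m))).
Proof.
move=> /test_summ[M HM] /test_summ[N HN] bB.
pose a (p : int * int) := phi p.1 * chi p.2 * b (p.1 + p.2).
have aMN : summ_by a (B * (M * N)).
  apply: summ_by_le_const (summ_byM HM HN); last exact: le_trans (cn_ge0 _) (bB 0).
  by move=> p; rewrite /a cnM mulrC ler_wpM2r ?cn_ge0.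
have -> : (fun j => phi j * tot (fun m => chi m * b (j + m))) =
    (fun j => tot (fun m => a (j, m))).
  apply/funext => j; rewrite -(@totZ _ _ _ (B * N)); last exact: summ_bounded.
  by congr tot; apply/funext => m; rewrite /a mulrA.
rewrite (tot_fubini aMN).
have H2 := summ_by_reindex shearK aMN.
have <- : tot (a \o shear) = tot a.
  by apply: totE; apply: (has_tot_reindex shearK unshearK); exact: summ_by_tot aMN.
rewrite -(tot_fubini H2); congr tot; apply/funext => l.
rewrite -(@totZ _ _ _ (M * N)).
  congr tot; apply/funext => j; rewrite /a /= mulrC; congr (_ * b _).
  by rewrite addrC subrK.
have := summ_by_reindex shearK (summ_byM HM HN) => H s us.
apply: le_trans (H [seq (l, j) | j <- s] _); first by rewrite big_map.
by rewrite map_inj_uniq // => u w [].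
Qed.

Lemma tval_conv phi chi t : test phi -> test chi ->
  tval (conv phi chi) t = tval phi t * tval chi t.
Proof.
move=> hp hc; have [N HN] := test_summ hc; have [M HM] := test_summ hp.
have e1 l : cn (ex l (- t)) <= 1 by rewrite cn_ex.
rewrite /tval mulrC -(totZ _ (summ_bounded e1 HM)).
under eq_fun do rewrite mulrC; rewrite (tot_conv hp hc e1).
congr tot; apply/funext => j; rewrite mulrCA; congr (_ * _).
rewrite mulrC -(totZ _ (summ_bounded e1 HN)).
by congr tot; apply/funext => m; rewrite exDl mulrCA.
Qed.

(** Moving the factor [phi] from the test function to the distribution; the two orders of summation
    agree by absolute convergence. *)
Lemma pairing_conv c B phi chi : (forall l, cn (c l) <= B) -> test phi -> test chi ->
  pairing c (conv phi chi) = pairing (mulF phi c) chi.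
Proof.
move=> cB hp hc; have [N HN] := test_summ hc; have [M HM] := test_summ hp.
rewrite /pairing (tot_conv hp hc cB).
pose a (p : int * int) := phi p.1 * chi p.2 * c (p.1 + p.2).
have aMN : summ_by a (B * (M * N)).
  apply: summ_by_le_const (summ_byM HM HN); last exact: le_trans (cn_ge0 _) (cB 0).
  by move=> p; rewrite /a cnM mulrC ler_wpM2r ?cn_ge0.
transitivity (tot (fun j => tot (fun m => a (j, m)))).
  congr tot; apply/funext => j; rewrite -(@totZ _ _ _ (B * N)); last exact: summ_bounded.
  by congr tot; apply/funext => m; rewrite /a mulrA.
rewrite (tot_swap aMN); congr tot; apply/funext => m.
rewrite mulrC /mulF -(@totZ _ _ _ (B * M)); last exact: summ_bounded.
by congr tot; apply/funext => j; rewrite /a /= mulrA [j + m]addrC [chi m * _]mulrC.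
Qed.

Lemma mulF_bounded c B psi M : (forall l, cn (c l) <= B) -> summ_by psi M ->
  forall m, cn (mulF psi c m) <= B * M.
Proof. by move=> cB pM m; apply: tot_norm; exact: summ_bounded. Qed.

End TestFunctions.

(** * Localization *)

Section PartialSums.
Variable R : realType.
Implicit Types (psi c d : int -> R[i]) (x t r : R).

Definition psum c (n : nat) x : R[i] := \sum_(l <- zseq n) c l * ex l x.

Lemma trig_psumE c n x : trig_psum c n x = psum c n x.
Proof. by rewrite /psum /zseq big_map. Qed.

Lemma psum_2pi c n x (m : int) : psum c n (x + 2 * pi * m%:~R) = psum c n x.
Proof. by apply: eq_bigr => l _; rewrite ex_2pi. Qed.

Lemma telescope_zseq (f : int -> R[i]) n :
  \sum_(l <- zseq n) f (l + 1) - \sum_(l <- zseq n) f l =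
  f (n%:Z + 1) - f (- n%:Z).
Proof.
rewrite -sumrB; elim: n => [|n IH].
  by rewrite (_ : zseq 0 = [:: 0]) // big_seq1.
rewrite zseq_ind IH (_ : - n.+1%:Z + 1 = - n%:Z); last by lia.
rewrite (_ : n%:Z + 1 = n.+1%:Z); last by lia.
ring.
Qed.

(** Each unit shift of the window [[-n, n]] trades two boundary terms, whose indices have modulus at
    least [n - k]; the hypothesis is written additively to avoid truncated subtraction. *)
Lemma psum_shift c n x (j : int) (k : nat) (eta : R) : (`|j| <= k)%N ->
  (forall l, (n <= `|l| + k)%N -> cn (c l) <= eta) ->
  cn (\sum_(m <- zseq n) c (m + j) * ex (m + j) x - psum c n x) <=
  2 * eta * (absz j)%:R.
Proof.
move=> jk ceta.
pose f l := c l * ex l x; pose T (i : int) := \sum_(m <- zseq n) f (m + i).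
have step i : cn (T (i + 1) - T i) <= cn (c (n%:Z + i + 1)) + cn (c (- n%:Z + i)).
  have := telescope_zseq (fun l => f (l + i)) n.
  rewrite /T; under [X in _ -> cn (X - _) <= _]eq_bigr => m _ do rewrite addrA addrAC.
  move=> ->; apply: le_trans (cn_triB _ _) _.
  by rewrite /f !cnM !cn_ex !mulr1 addrAC.
have T0 : T 0 = psum c n x by apply: eq_bigr => m _; rewrite addr0.
rewrite -/(T j) -T0; case: j jk => i.
  elim: i => [|i IH] ik; first by rewrite subrr cn0 mulr0.
  apply: le_trans (cn_dist (T i%:Z) _ _) _.
  have -> : i.+1%:Z = i%:Z + 1 by lia.
  rewrite (_ : absz (i%:Z + 1) = (i + 1)%N); last by lia.
  rewrite natrD mulrDr mulr1 addrC lerD ?IH ?(ltnW ik) //.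
  apply: le_trans (step _) _; rewrite mulr2n mulrDl mul1r.
  by rewrite lerD // ceta //; lia.
rewrite NegzE; move: (i.+1) => {}i.
elim: i => [|i IH] ik; first by rewrite oppr0 subrr cn0 mulr0.
apply: le_trans (cn_dist (T (- i%:Z)) _ _) _.
rewrite (_ : absz (- i.+1%:Z) = (i + 1)%N); last by lia.
have {}IH : cn (T (- i%:Z) - T 0) <= 2 * eta * i%:R.
  by have := IH _; rewrite abszN; apply; lia.
rewrite natrD mulrDr mulr1 addrC lerD //.
have := step (- i.+1%:Z); rewrite (_ : - i.+1%:Z + 1 = - i%:Z); last by lia.
rewrite cnB => /le_trans; apply; rewrite mulr2n mulrDl mul1r.
by rewrite lerD // ceta //; lia.
Qed.

(** The share of the frequency [j] of [psi] in the defect between the partial sum of the product and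
    [psi] times the partial sum. *)
Definition psum_err c n x (j : int) : R[i] :=
  \sum_(m <- zseq n) c (m + j) * ex m x - ex j (- x) * psum c n x.

Lemma psum_errE c n x j : psum_err c n x j =
  ex j (- x) * (\sum_(m <- zseq n) c (m + j) * ex (m + j) x - psum c n x).
Proof.
rewrite mulrBr /psum_err; congr (_ - _); rewrite mulr_sumr; apply: eq_bigr => m _.
have E : ex j (- x) * ex j x = 1 by rewrite -exN exNK.
by rewrite exDl -[LHS]mul1r -E; ring.
Qed.

Lemma psum_err_bound c B n x j : (forall l, cn (c l) <= B) ->
  cn (psum_err c n x j) <= 2 * B * wt R j.
Proof.
move=> cB; rewrite psum_errE cnM cn_ex mul1r.
apply: le_trans (psum_shift x (leqnn _) (fun l _ => cB l)) _.
rewrite ler_wpM2l ?lerDr // mulr_ge0 //; exact: le_trans (cn_ge0 _) (cB 0).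
Qed.

Lemma psum_err_to0 c x j : (forall e, 0 < e -> exists N, forall l, (N <= `|l|)%N -> cn (c l) <= e) ->
  forall e, 0 < e -> exists N, forall n, (N <= n)%N -> cn (psum_err c n x j) <= e.
Proof.
move=> c0 e e0; have w0 : 0 < 2 * wt R j by rewrite mulr_gt0 // wt_gt0.
have [N HN] := c0 _ (divr_gt0 e0 w0).
exists (N + `|j|)%N => n nN; rewrite psum_errE cnM cn_ex mul1r.
apply: le_trans (psum_shift (eta := e / (2 * wt R j)) x (leqnn _) _) _.
  by move=> l hl; apply: HN; lia.
have w1 : 0 < wt R j by exact: wt_gt0.
have -> : 2 * (e / (2 * wt R j)) * (absz j)%:R = e * (absz j)%:R / wt R j.
  by field; rewrite gt_eqF.
by rewrite ler_pdivrMr // ler_pM2l // lerDr.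
Qed.

(** The localization principle as an exact formula. The weighted bound makes the defect bounded
    uniformly in [n] and [x], and serves as majorant when it is shown to tend to zero. *)
Lemma psum_mulF c B psi M n x : (forall l, cn (c l) <= B) ->
  summ_by (fun l => (wt R l)%:C * psi l) M ->
  summ_by (fun j => psi j * psum_err c n x j) (2 * B * M) /\
  psum (mulF psi c) n x - tval psi x * psum c n x =
    tot (fun j => psi j * psum_err c n x j).
Proof.
move=> cB HM; have B0 : 0 <= B by exact: le_trans (cn_ge0 _) (cB 0).
have [N HN] : exists N, summ_by psi N by apply: test_summ; exists M.
have S : summ_by (fun j => psi j * psum_err c n x j) (2 * B * M).
  apply: summ_by_le_const HM; last by rewrite mulr_ge0.
  move=> j; rewrite !cnM cn_real gtr0_norm ?wt_gt0 // mulrC mulrA.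
  by rewrite ler_wpM2r ?cn_ge0 // psum_err_bound.
split=> //; apply/esym/totE.
have h1 : has_tot (fun j => \sum_(m <- zseq n) ex m x * (psi j * c (m + j))) (psum (mulF psi c) n x).
  rewrite /psum; under [X in has_tot _ X]eq_bigr => m _ do rewrite mulrC.
  apply: has_tot_sum => m; apply: has_totZ.
  by apply: summ_by_tot; apply: (summ_bounded (B := B)) HN => l.
have h2 : has_tot (fun j => - psum c n x * (psi j * ex j (- x))) (- psum c n x * tval psi x).
  apply: has_totZ; apply: (summ_by_tot (M := 1 * N)); apply: summ_bounded HN => l.
  by rewrite cn_ex.
have := has_totD h1 h2; rewrite mulNr [psum c n x * _]mulrC.
congr (has_tot _ _); apply/funext => j.
rewrite /psum_err mulrBr mulr_sumr mulNr; congr (_ - _).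
  by apply: eq_bigr => m _; rewrite mulrC -mulrA.
by rewrite mulrC -mulrA.
Qed.

End PartialSums.

(** * Support of the distribution *)

Section Nested.
Variable R : realType.

Lemma nested_point (x r : nat -> R) :
  (forall i, `|x i.+1 - x i| + r i.+1 <= r i) -> (forall i, 0 <= r i) ->
  exists z, forall i, `|z - x i| <= r i.
Proof.
move=> H r0.
have lo i k : x i - r i <= x (i + k)%N - r (i + k)%N /\ x (i + k)%N + r (i + k)%N <= x i + r i.
  elim: k => [|k [h1 h2]]; first by rewrite addn0 !lexx.
  have := H (i + k)%N; rewrite addnS.
  have := ler_norm (x (i + k).+1 - x (i + k)%N).
  have := ler_norm (- (x (i + k).+1 - x (i + k)%N)); rewrite normrN.
  by move=> ? ? ?; split; lra.
pose E := [set y | exists i, y = x i - r i].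
have ubE i : ubound E (x i + r i).
  move=> _ [j ->]; have [_ h1] := lo i j; have [h2 _] := lo j i.
  have := r0 (i + j)%N; rewrite addnC in h2; lra.
exists (sup E) => i; rewrite ler_norml.
have h1 : sup E <= x i + r i by apply: ge_sup; [exists (x i - r i), i|exact: ubE].
have h2 : x i - r i <= sup E.
  by apply: ub_le_sup; [exists (x i + r i); exact: ubE|exists i].
apply/andP; split; lra.
Qed.

End Nested.

Section Spectrum.
Variable R : realType.
Implicit Types (psi c d : int -> R[i]) (x y z t r h : R).

Definition vanishes_off psi x r := forall t, far r (t - x) -> tval psi t = 0.

(* [spec c] is the support of the distribution [\sum_l c_l e^{ilx}]. *)
Definition spec c : set R := [set x | forall r, 0 < r ->
  exists psi, [/\ test psi, vanishes_off psi x r & pairing c psi <> 0]].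

Lemma spec_2pi c x (m : int) : spec c x -> spec c (x + 2 * pi * m%:~R).
Proof.
move=> sx r r0; have [psi [tp vp np]] := sx r r0; exists psi; split=> // t ft.
apply: vp => k; have := ft (k - m).
by rewrite (_ : _ - _ - _ = t - x - 2 * pi * k%:~R) // rmorphB /=; ring.
Qed.

(** The B-spline centred at [y]; [pairing d (spline h y)] is the value at [y] of the distribution
    convolved with the B-spline. *)
Definition spline h y (l : int) : R[i] := (spl h l)%:C * ex l y.

Lemma spline_test h y : 0 < h -> test (spline h y).
Proof.
move=> /summ_by_wspl[M HM]; exists M; apply: summ_by_le HM => l.
have -> : (wt R l)%:C * spline h y l = (wt R l * spl h l)%:C * ex l y.
  by rewrite /spline [(wt R l * _)%:C]rmorphM mulrA.
by rewrite cnM cn_ex mulr1.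
Qed.

Lemma spline_vanishes h y e : 0 < h -> 0 < e -> vanishes_off (spline h y) y (4 * h + e).
Proof.
move=> h0 e0 t ft; rewrite /tval.
have -> : (fun j => spline h y j * ex j (- t)) = (fun l => (spl h l)%:C * ex l (y - t)).
  by apply/funext => j; rewrite /spline exDr mulrA.
apply: (spline_support h0 e0) => m; have := ft (- m).
have -> : y - t - 2 * pi * m%:~R = - (t - y - 2 * pi * (- m)%:~R).
  by rewrite mulrNz; ring.
by rewrite normrN addrC.
Qed.

(** The pairing is the mean of the pairings with the translates to [y + u] and [y - u], so one of
    these is nonzero. *)
Lemma pairing_cos d b u y M B : 0 <= u -> (forall l, cn (d l) <= B) ->
  summ_by (fun l => (b l)%:C : R[i]) M ->
  pairing d (fun l => (b l * cos (l%:~R * u))%:C * ex l y) <> 0 ->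
  exists2 y', `|y' - y| <= u & pairing d (fun l => (b l)%:C * ex l y') <> 0.
Proof.
move=> u0 dB bM H; apply: contrapT => N.
have hz y' : `|y' - y| <= u -> pairing d (fun l => (b l)%:C * ex l y') = 0.
  by move=> hy; apply: contrapT => h; apply: N; exists y'.
have S y' : has_tot (fun l => d l * ((b l)%:C * ex l y')) (pairing d (fun l => (b l)%:C * ex l y')).
  apply: (summ_by_tot (M := B * M)).
  have := summ_bounded (b := fun l => d l * ex l y') (B := B) _ bM.
  move=> /(_ _)/wrap[l|]; first by rewrite cnM cn_ex mulr1.
  by congr (summ_by _ _); apply/funext => l; ring.
apply: H; have := has_totZ (2%:R^-1) (has_totD (S (y + u)) (S (y - u))).
have e1 : `|y + u - y| <= u by rewrite addrAC subrr add0r ger0_norm.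
have e2 : `|y - u - y| <= u by rewrite addrAC subrr add0r normrN ger0_norm.
rewrite (hz _ e1) (hz _ e2).
rewrite addr0 mulr0 => h; apply: totE; move: h; congr (has_tot _ _).
apply/funext => l; rewrite -!mulrDr rmorphM.
have := cos_ex l u y; move: (ex _ _ + ex _ _) => z E.
rewrite -[X in _ = _ * X]mulrA [_ * ex l y]mulrC E.
by rewrite [LHS]mulrC -!mulrA.
Qed.

Lemma pairing_half d B h y : (forall l, cn (d l) <= B) -> 0 < h ->
  pairing d (spline h y) <> 0 ->
  exists2 y', `|y' - y| <= 2 * h & pairing d (spline (h / 2) y') <> 0.
Proof.
move=> dB h0 H; have h20 : 0 < h / 2 by rewrite divr_gt0.
have [M HM] : exists M, summ_by (fun l => (spl (h / 2) l)%:C : R[i]) M.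
  have [M HM] := test_summ (spline_test 0 h20); exists M.
  by apply: summ_by_le HM => l; rewrite /spline exr0 mulr1.
have sb b : summ_by (fun l => (b l)%:C : R[i]) M ->
    summ_by (fun l => (b l * cos (l%:~R * (h / 2)))%:C : R[i]) M.
  apply: summ_by_le => l; rewrite !cn_real normrM ler_piMr ?cos_max //.
pose b1 l := spl (h / 2) l * cos (l%:~R * (h / 2)).
pose b2 l := b1 l * cos (l%:~R * (h / 2)).
pose b3 l := b2 l * cos (l%:~R * (h / 2)).
have S1 := sb _ HM; have S2 := sb b1 S1; have S3 := sb b2 S2.
have : pairing d (fun l => (b3 l * cos (l%:~R * (h / 2)))%:C * ex l y) <> 0.
  by move: H; congr (pairing _ _ <> _); apply/funext => l; rewrite /spline spl_half.
move=> /(pairing_cos (ltW h20) dB S3)[y1 d1 /(pairing_cos (ltW h20) dB S2)[y2 d2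
  /(pairing_cos (ltW h20) dB S1)[y3 d3 /(pairing_cos (ltW h20) dB HM)[y4 d4 H4]]]].
exists y4 => //; move: d1 d2 d3 d4; rewrite !ler_norml.
move=> /andP[? ?] /andP[? ?] /andP[? ?] /andP[? ?]; apply/andP; split; lra.
Qed.

(** A descent replaces partitions of unity and compactness. A nonzero pairing at scale [h] yields
    one at scale [h / 2] with centre moved by at most [2 h]; the centres converge to a point [z]
    within [4 h] of [y], and the products of [psi] with these splines put [z] into the support. *)
Lemma pairing_off_spec c B psi h y : (forall l, cn (c l) <= B) -> test psi -> 0 < h ->
  (forall z, spec c z -> 4 * h < `|z - y|) ->
  pairing (mulF psi c) (spline h y) = 0.
Proof.
move=> cB tp h0 off; apply: contrapT => H0.
have [M pM] := test_summ tp.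
set d := mulF psi c in H0; have dB := mulF_bounded cB pM : forall l, cn (d l) <= B * M.
pose hh (i : nat) := h / 2 ^+ i.
have hh0 i : 0 < hh i by rewrite divr_gt0 // exprn_gt0.
have hhS i : hh i.+1 = hh i / 2 by rewrite /hh exprS invfM mulrA mulrAC.
pose P (p : nat * R) (q : R) := pairing d (spline (hh p.1) p.2) <> 0 ->
  `|q - p.2| <= 2 * hh p.1 /\ pairing d (spline (hh p.1.+1) q) <> 0.
have HP p : exists q, P p q.
  case: p => i y'; rewrite /P /=; case: (pselect (pairing d (spline (hh i) y') <> 0)) => [h1|h1].
    have [y2 h2 h3] := pairing_half dB (hh0 i) h1; exists y2 => _.
    by rewrite hhS.
  by exists 0 => /h1.
have [f Hf] := boolp.choice HP.
pose ys := fix ys i := if i is j.+1 then f (j, ys j) else y.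
have ysP i : pairing d (spline (hh i) (ys i)) <> 0.
  elim: i => [|i IH]; first by rewrite /hh expr0 divr1.
  by have [_] := Hf (i, ys i) IH.
have [z Hz] : exists z, forall i, `|z - ys i| <= 4 * hh i.
  apply: nested_point => i; last by rewrite mulr_ge0 // ltW.
  by have [h1 _] := Hf (i, ys i) (ysP i); rewrite hhS /= in h1 *; lra.
have /existsNP[r /not_implyP[r0 Hr]] : ~ spec c z.
  move=> /off; rewrite ltNge => /negP; apply.
  by have := Hz 0%N; rewrite /hh expr0 divr1.
pose i := Num.truncn (16 * h / r); have hi : 16 * h / r < i.+1%:R.
  by apply: truncnS_gt; rewrite num_real.
(* The spline reaches [4 hh i.+1] from its centre, which is itself within [4 hh i.+1] of [z]; the
   other [r / 2] is the slack that [spline_vanishes] asks for. *)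
have hir : 8 * hh i.+1 <= r / 2.
  rewrite ltr_pdivrMr // in hi.
  have : i.+1%:R <= 2 ^+ i.+1 :> R by rewrite -natrX ler_nat ltnW // ltn_expl.
  have p0 : 0 < 2 ^+ i.+1 :> R by rewrite exprn_gt0.
  rewrite /hh mulrA ler_pdivrMr // => h1.
  have := ler_wpM2r (ltW r0) h1; lra.
apply: (ysP i.+1); rewrite -(pairing_conv cB tp (spline_test _ (hh0 _))).
apply: contrapT => hn; apply: Hr.
exists (conv psi (spline (hh i.+1) (ys i.+1))); split=> //.
  by apply: test_conv => //; exact: spline_test.
move=> t ft; rewrite tval_conv //; last exact: spline_test.
rewrite (spline_vanishes (e := r / 2)) ?mulr0 ?divr_gt0 // => m.
have := ft m; have := Hz i.+1.
have := ler_normD (t - ys i.+1 - 2 * pi * m%:~R) (- (z - ys i.+1)); rewrite normrN.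
rewrite (_ : _ + - (z - _) = t - z - 2 * pi * m%:~R); last by ring.
lra.
Qed.

(** If the support is empty, splines of every width pair to zero. After multiplication by a
    character bringing [c l0] to frequency [0], a very wide spline keeps [c l0] and makes all other
    terms small. *)
Lemma spec_nonempty c B : (forall l, cn (c l) <= B) -> (exists l, c l <> 0) ->
  exists x, spec c x.
Proof.
move=> cB [l0 cl0]; apply: contrapT => /forallNP noS; apply: cl0.
pose psi (j : int) : R[i] := (j == l0)%:R.
have fin (a : int -> R[i]) : has_tot (fun j => psi j * a j) (a l0).
  have := @has_tot_finite R (fun j => psi j * a j) [:: l0] isT.
  rewrite big_seq1 /psi eqxx mul1r; apply => l.
  by rewrite inE => /negPf ->; rewrite mul0r.
have tp : test psi.
  exists (wt R l0) => s us.
  apply: (@le_trans _ _ (\sum_(j <- s) if j == l0 then wt R l0 else 0)).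
    apply: ler_sum => j _; rewrite cnM /psi cn_real gtr0_norm ?wt_gt0 //.
    by case: eqP => [->|_]; rewrite ?Normc.normc1 ?mulr1 ?cn0 ?mulr0.
  rewrite -big_mkcond /= -big_filter.
  have [ls|ls] := boolP (l0 \in s); last first.
    rewrite big_seq big1 => [|j]; first by rewrite ltW // wt_gt0.
    by rewrite mem_filter => /andP[/eqP -> h]; rewrite h in ls.
  by rewrite filter_pred1_uniq // big_seq1.
have E m : mulF psi c m = c (m + l0) by apply: totE; exact: fin.
apply: cn_small => e e0.
have B0 : 0 <= B by exact: le_trans (cn_ge0 _) (cB 0).
(* [48 = 16 * 3]: the terms with [l] nonzero are at most [16 B / h^4] times [1 / wt^2], the inverse
   squares of [wt] sum to at most [3], and [h <= h^4]. *)
pose h : R := 1 + 48 * B / e; have h1 : 1 <= h by rewrite lerDl !mulr_ge0 // invr_ge0 ltW.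
have h0 : 0 < h by lra.
have h41 : h <= h ^+ 4 by rewrite -[leLHS]expr1 ler_weXn2l.
have h40 : 0 < h ^+ 4 by rewrite exprn_gt0.
have P : pairing (mulF psi c) (spline h 0) = 0.
  by apply: (pairing_off_spec cB) => // z /noS.
have dB l : cn (mulF psi c l) <= B by rewrite E.
have [M HM] := test_summ (spline_test 0 h0).
have H1 := summ_by_tot (summ_bounded dB HM).
have H2 : has_tot (fun l : int => (l == 0)%:R * - c l0) (- c l0).
  have := @has_tot_finite R (fun l : int => (l == 0)%:R * - c l0) [:: 0] isT.
  rewrite big_seq1 eqxx mul1r; apply => l.
  by rewrite inE => /negPf ->; rewrite mul0r.
have H3 := has_totD H1 H2.
have -> : cn (c l0) = cn (tot (fun l => spline h 0 l * mulF psi c l) + - c l0).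
  have -> : tot (fun l => spline h 0 l * mulF psi c l) = 0.
    by rewrite -[RHS]P; congr tot; apply/funext => l; rewrite mulrC.
  by rewrite add0r cnN.
rewrite -(totE H3); apply: (@le_trans _ _ (16 * B / h ^+ 4 * 3)); last first.
  rewrite mulrAC ler_pdivrMr //; apply: (@le_trans _ _ (e * h)); last by rewrite ler_pM2l.
  have -> : e * h = e + 48 * B by rewrite /h; field; rewrite gt_eqF.
  lra.
apply: tot_norm; apply: (summ_by_le_const _ _ (summ_by_inv_wt R)); last first.
  by rewrite !mulr_ge0 // invr_ge0 ltW.
move=> l; have [->|l0'] := eqVneq l 0.
  rewrite mul1r E add0r /spline exr0 mulr1 /spl mul0r sinc0 expr1n mul1r subrr cn0.
  by rewrite mulr_ge0 ?cn_ge0 // !mulr_ge0 // invr_ge0 ltW.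
rewrite mul0r addr0 /spline !cnM cn_ex mulr1 !cn_real (ger0_norm (spl_ge0 _ _)).
have w0 := wt_gt0 R l; rewrite ger0_norm ?invr_ge0 ?exprn_ge0 ?(ltW w0) //.
have lw : wt R l <= 2 * (absz l)%:R.
  by rewrite /wt mulr2n mulrDl mul1r lerD2r ler1n; lia.
have := spl_decay h l; rewrite -intr_norm (gtr0_norm h0) exprMn.
have -> : (`|l|%R%:~R = (absz l)%:R :> R) by rewrite natr_absz.
set q : R := (absz l)%:R in lw *; move=> hs.
have q1 : 1 <= q by rewrite ler1n; lia.
have w2 : wt R l ^+ 2 <= 16 * q ^+ 4.
  apply: (@le_trans _ _ (wt R l ^+ 4)); first by rewrite ler_weXn2l // wt_ge1.
  have : wt R l ^+ 4 <= (2 * q) ^+ 4 by rewrite lerXn2r ?nnegrE ?(ltW w0) // mulr_ge0 //; lra.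
  have -> : (2 * q) ^+ 4 = 16 * q ^+ 4 by ring.
  by [].
rewrite (_ : 16 * B / h ^+ 4 * _ = B * (16 / (h ^+ 4 * wt R l ^+ 2))); last first.
  by field; rewrite !gt_eqF.
rewrite mulrC ler_pM ?cn_ge0 ?spl_ge0 //.
rewrite ler_pdivlMr ?mulr_gt0 ?exprn_gt0 //.
have s0 := spl_ge0 h l.
have := ler_wpM2l (mulr_ge0 s0 (ltW h40)) w2.
lra.
Qed.

End Spectrum.

(** * Baire's theorem and restriction to a portion of the support *)

Section Portion.
Variable R : realType.
Implicit Types (psi c d : int -> R[i]) (x y z t r h : R).

(* [K] need not be closed: if the conclusion fails, nested intervals centred in
   [K] shrink to a point, possibly outside [K], where the [f k] are unbounded. *)
Lemma bounded_portion (K : set R) (f : nat -> R -> R[i]) :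
  (exists x, K x) ->
  (forall k, exists L, forall x y, cn (f k x - f k y) <= L * `|x - y|) ->
  (forall x, exists C, forall k, cn (f k x) <= C) ->
  exists x0 r C, [/\ K x0, 0 < r &
    forall x, K x -> `|x - x0| < r -> forall k, cn (f k x) <= C].
Proof.
move=> [x0 Kx0] fL fb; apply: contrapT => N0.
have N x r C : K x -> 0 < r -> exists x' k, [/\ K x', `|x' - x| < r & C < cn (f k x')].
  move=> Kx r0; apply: contrapT => N1; apply: N0; exists x, r, C; split=> // x' Kx' xr k.
  by rewrite leNgt; apply/negP => h; apply: N1; exists x', k.
pose P (p : nat * (R * R)) (q : R * R) := K p.2.1 -> 0 < p.2.2 ->
  [/\ K q.1, 0 < q.2, `|q.1 - p.2.1| + q.2 <= p.2.2 &
   exists k, forall t, `|t - q.1| <= q.2 -> p.1%:R <= cn (f k t)].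
have HP p : exists q, P p q.
  case: p => i [x r]; rewrite /P /=.
  case: (pselect (K x /\ 0 < r)) => [[Kx r0]|h]; last by exists (0, 0) => *; case: h.
  have [x' [k [Kx' xr Cx]]] := N x r (i%:R + 1) Kx r0.
  have [L HL] := fL k.
  have L0 : 0 < `|L| + 1 by rewrite ltr_wpDl.
  (* At the centre the modulus exceeds [i + 1], and by the Lipschitz bound it drops by at most [1]
     over a radius [1 / (|L| + 1)]; so it is at least [i] on the whole interval. *)
  exists (x', Num.min (r - `|x' - x|) (`|L| + 1)^-1) => _ _ /=; split=> //.
  - by rewrite lt_min subr_gt0 xr invr_gt0.
  - by rewrite addrC -lerBrDr ge_min lexx.
  exists k => t; rewrite le_min => /andP[_ ht].
  have h1 : L * `|x' - t| <= 1.
    apply: (@le_trans _ _ ((`|L| + 1) * `|x' - t|)).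
      by rewrite ler_wpM2r //; have := ler_norm L; lra.
    by rewrite distrC -ler_pdivlMl // mulr1.
  have := HL x' t; have := cnD (f k x' - f k t) (f k t); rewrite subrK; lra.
have [g Hg] := boolp.choice HP.
pose s := fix s i := if i is j.+1 then g (j, s j) else (x0, 1).
have sP i : K (s i).1 /\ 0 < (s i).2.
  elim: i => [|i [h1 h2]] //=.
  by have [] := Hg (i, s i) h1 h2.
have [z Hz] : exists z, forall i, `|z - (s i).1| <= (s i).2.
  apply: nested_point => i; last by have [_ /ltW] := sP i.
  by have [h1 h2] := sP i; have [] := Hg (i, s i) h1 h2.
have [C HC] := fb z; pose i := (Num.truncn C).+1.
have iC : C < i%:R by apply: truncnS_gt; rewrite num_real.
have [h1 h2] := sP i; have [_ _ _ [k]] := Hg (i, s i) h1 h2.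
by move=> /(_ z (Hz i.+1)); rewrite leNgt (le_lt_trans (HC k) iC).
Qed.

Lemma expi_sub1 (u : R) : cn (expi u - 1) <= 2 * `|u|.
Proof.
apply: le_trans (cn_le _) _; rewrite /expi /= oppr0 addr0 mulr2n mulrDl mul1r.
rewrite lerD ?sin_le_norm //.
have := @derive_bound R cos (fun x => - sin x) 1 u (fun x => is_derive_cos x).
by rewrite cos0 mul1r; apply => x _; rewrite normrN sin_max.
Qed.

Lemma psum_lipschitz c n : exists L, forall x y,
  cn (psum c n x - psum c n y) <= L * `|x - y|.
Proof.
exists (\sum_(l <- zseq n) cn (c l) * (2 * (absz l)%:R)) => x y.
rewrite /psum -sumrB mulr_suml; apply: le_trans (cn_sum _ _) _.
apply: ler_sum => l _; rewrite -mulrBr cnM -mulrA ler_wpM2l ?cn_ge0 //.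
have -> : ex l x - ex l y = ex l y * (ex l (x - y) - 1).
  by rewrite mulrBr mulr1 -exDr (addrC y) subrK.
rewrite cnM cn_ex mul1r; apply: le_trans (expi_sub1 _) _.
by rewrite normrM -mulrA natr_absz intr_norm.
Qed.

Lemma eventually_bounded (u : nat -> R) k0 : (forall k, 0 <= u k) ->
  (forall k, (k0 <= k)%N -> u k <= 1) -> exists C, forall k, u k <= C.
Proof.
move=> u0 H; exists (1 + \sum_(k < k0) u k) => k.
have [/H|kk] := leqP k0 k.
  by move=> /le_trans; apply; rewrite lerDl sumr_ge0.
rewrite (bigD1 (Ordinal kk)) //= addrCA lerDl addr_ge0 //.
by rewrite sumr_ge0.
Qed.

(** The test function [psi] comes from the definition of the support at the centre of the portion,
    with the portion's radius. The coefficient [d 0] is then its pairing with [c], hence nonzero.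
    All of [spec c] can serve as [K]: outside the portion [psi] vanishes, and only the bounded
    localization error remains. *)
Lemma localization c (n : nat -> nat) :
  (forall e, 0 < e -> exists N, forall l, (N <= `|l|)%N -> cn (c l) <= e) ->
  (forall N, exists k0, forall k, (k0 <= k)%N -> (N <= n k)%N) ->
  (forall x e, 0 < e -> exists k0, forall k, (k0 <= k)%N -> cn (psum c (n k) x) <= e) ->
  (exists l, c l <> 0) ->
  exists d (K : set R) B C, [/\ d 0 <> 0, forall l, cn (d l) <= B,
    forall x e, 0 < e -> exists k0, forall k, (k0 <= k)%N -> cn (psum d (n k) x) <= e,
    forall y, K y -> forall k, cn (psum d (n k) y) <= C &
    forall y h, 0 < h -> (forall z, K z -> 4 * h < `|z - y|) ->
      pairing d (spline h y) = 0].
Proof.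
move=> c0 noo pc cne.
have [B cB] : exists B, forall l, cn (c l) <= B.
  have [N HN] := c0 1 ltr01; exists (1 + \sum_(l <- zseq N) cn (c l)) => l.
  have [/HN|kk] := leqP N `|l|.
    by move=> /le_trans; apply; rewrite lerDl sumr_ge0 // => i _; exact: cn_ge0.
  rewrite (big_rem l) /=; last by rewrite mem_zseq ltnW.
  by rewrite addrCA lerDl addr_ge0 // sumr_ge0 // => i _; exact: cn_ge0.
have B0 : 0 <= B by exact: le_trans (cn_ge0 _) (cB 0).
have [] := @bounded_portion (spec c) (fun k => psum c (n k)).
- exact: spec_nonempty cB cne.
- by move=> k; exact: psum_lipschitz.
- move=> x; have [k0 H] := pc x 1 ltr01.
  by apply: (@eventually_bounded _ k0) => // k; exact: cn_ge0.
move=> x0 [r [C [Kx0 r0 HC]]].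
have [psi [tp vp np]] := Kx0 r r0.
have [M HM] := tp; have [M' HM'] := test_summ tp.
have Q x k := psum_mulF (n k) x cB HM.
exists (mulF psi c), (spec c), (B * M'), (2 * B * M + M' * C); split.
- move: np; congr (_ <> _); congr tot; apply/funext => l; rewrite add0r mulrC //.
- exact: mulF_bounded.
- move=> x e e0; have e20 : 0 < e / 2 by rewrite divr_gt0.
  have B2 : 0 <= 2 * B by rewrite mulr_ge0.
  (* Dominated convergence over the frequencies [j] of [psi]: each error tends to zero because [c]
     does. *)
  have D := @tot_dominated R _ (fun k j => psi j * psum_err c (n k) x j)
    (fun j => (2 * B)%:C * ((wt R j)%:C * psi j)) (2 * B * M).
  have [||i e1 e10|k1 H1] := D _ _ _ (e / 2) e20.
  + move=> k j; rewrite !cnM !cn_real !ger0_norm ?mulr_ge0 // ?(ltW (wt_gt0 _ _)) //.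
    by rewrite mulrC mulrA ler_wpM2r ?cn_ge0 // psum_err_bound.
  + apply: summ_by_le_const HM; last by rewrite mulr_ge0.
    by move=> j; rewrite [in leLHS]cnM cn_real (ger0_norm B2).
  + have p0 : 0 < cn (psi i) + 1 by rewrite ltr_wpDl ?cn_ge0.
    have [N HN] := psum_err_to0 x i c0 (divr_gt0 e10 p0).
    have [k1 Hk1] := noo N; exists k1 => k /Hk1/HN h.
    rewrite cnM; apply: le_trans (ler_wpM2l (cn_ge0 _) h) _.
    by rewrite mulrCA ler_piMr ?(ltW e10) // ler_pdivrMr // mul1r lerDl.
  have p0 : 0 < cn (tval psi x) + 1 by rewrite ltr_wpDl ?cn_ge0.
  have [k2 H2] := pc x _ (divr_gt0 e20 p0).
  exists (maxn k1 k2) => k; rewrite geq_max => /andP[/H1 h1 /H2 h2].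
  have [_ E] := Q x k.
  rewrite -[psum (mulF _ _) _ _](subrK (tval psi x * psum c (n k) x)) E.
  apply: le_trans (cnD _ _) _; rewrite (splitr e) lerD //.
  rewrite cnM; apply: le_trans (ler_wpM2l (cn_ge0 _) h2) _.
  by rewrite mulrCA ler_piMr ?(ltW e20) // ler_pdivrMr // mul1r lerDl.
- move=> y Ky k; have [S E] := Q y k.
  rewrite -[psum (mulF _ _) _ _](subrK (tval psi y * psum c (n k) y)) E.
  apply: le_trans (cnD _ _) _; rewrite lerD ?(tot_norm S) // cnM.
  have tM : cn (tval psi y) <= M'.
    apply: tot_norm; apply: summ_by_le HM' => l.
    by rewrite cnM cn_ex mulr1.
  have C0 : 0 <= C.
    by apply: le_trans (cn_ge0 _) (HC x0 Kx0 _ 0%N); rewrite subrr normr0.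
  case: (pselect (far r (y - x0))) => [ft|nf].
    by rewrite vp // cn0 mul0r mulr_ge0 // (le_trans (cn_ge0 _) tM).
  have [m Hm] : exists m : int, `|y - x0 - 2 * pi * m%:~R| < r.
    apply: contrapT => h; apply: nf => m; rewrite leNgt; apply/negP => h1.
    by apply: h; exists m.
  apply: ler_pM; rewrite ?cn_ge0 //.
  rewrite -(psum_2pi _ _ _ (- m)); apply: HC; first exact: spec_2pi.
  by rewrite (_ : _ - x0 = y - x0 - 2 * pi * m%:~R) // mulrNz; ring.
- by move=> y h h0 off; exact: (pairing_off_spec cB tp h0).
Qed.

End Portion.

(** * Bounded energy *)

Section Energy.
Variable R : realType.
Implicit Types (a b d : int -> R[i]) (x : R).

Definition energy a (n : nat) : R := \sum_(l <- zseq n) cn (a l) ^+ 2.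

Lemma cn_sqrC (z : R[i]) : (cn z ^+ 2)%:C = z * conjc z.
Proof.
case: z => u v; rewrite cn_sqr /=; simpc; congr (_ +i* _).
by rewrite mulrC addNr.
Qed.

Lemma conjcM (z w : R[i]) : conjc (z * w) = conjc z * conjc w.
Proof. exact: rmorphM. Qed.

Lemma conjc_psum a n x :
  conjc (psum a n x) = \sum_(l <- zseq n) conjc (a l) * ex (- l) x.
Proof.
transitivity (\sum_(l <- zseq n) conjc (a l * ex l x)); first exact: rmorph_sum.
by apply: eq_bigr => l _; rewrite conjcM exJ.
Qed.

Lemma energy_mono a m n : (m <= n)%N -> energy a m <= energy a n.
Proof.
move=> mn; apply: sum_subset; rewrite ?uniq_zseq //.
  by move=> l; rewrite sqr_ge0.
by move=> l; rewrite !mem_zseq => /leq_trans; apply.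
Qed.

(** Lets a polynomial of degree [n] be treated as one of degree [L >= n], so that two polynomials
    share the same index set and grid. *)
Definition cutoff (n : nat) a (l : int) : R[i] := if (`|l| <= n)%N then a l else 0.

Lemma sum_cutoff (V : nmodType) (F : int -> V) n L : (n <= L)%N ->
  \sum_(l <- zseq L) (if (`|l| <= n)%N then F l else 0) = \sum_(l <- zseq n) F l.
Proof.
move=> nL; rewrite -big_mkcond /= -big_filter; apply: perm_big.
apply: uniq_perm; rewrite ?filter_uniq ?uniq_zseq // => l.
rewrite mem_filter !mem_zseq; lia.
Qed.

Lemma psum_cutoff n a L x : (n <= L)%N -> psum (cutoff n a) L x = psum a n x.
Proof.
move=> nL; rewrite /psum -(sum_cutoff _ nL); apply: eq_bigr => l _.
by rewrite /cutoff; case: ifP => //; rewrite mul0r.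
Qed.

Let I2pi : set R := `[0, 2 * pi]%classic.

(** Integrability and value travel together, so that linear combinations create no side
    conditions. *)
Definition hasint (f : R -> R) (v : R) :=
  lebesgue_measure.-integrable I2pi (EFin \o f) /\
  (\int[lebesgue_measure]_(x in I2pi) (f x)%:E = v%:E)%E.

Lemma hasintD f g v w : hasint f v -> hasint g w ->
  hasint (fun x => f x + g x) (v + w).
Proof.
move=> [f1 f2] [g1 g2]; split.
  rewrite (_ : EFin \o _ = (EFin \o f) \+ (EFin \o g))%E //.
  by apply: integrableD => //; exact: measurable_itv.
by rewrite EFinD -f2 -g2 -integralD //; exact: measurable_itv.
Qed.

Lemma hasint0 : hasint (fun=> 0) 0.
Proof.
split; first exact: integrable0.
by rewrite integral0.
Qed.

Lemma hasint_sum (I : Type) (s : seq I) (f : I -> R -> R) (v : I -> R) :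
  (forall i, hasint (f i) (v i)) ->
  hasint (fun x => \sum_(i <- s) f i x) (\sum_(i <- s) v i).
Proof.
move=> H; elim: s => [|i s IH].
  rewrite big_nil (_ : (fun _ => _) = (fun=> 0)); first exact: hasint0.
  by apply/funext => x; rewrite big_nil.
rewrite big_cons (_ : (fun _ => _) = (fun x => f i x + \sum_(j <- s) f j x)).
  exact: hasintD.
by apply/funext => x; rewrite big_cons.
Qed.

Lemma hasint_ftc (f F : R -> R) : continuous f -> (forall x, is_derive x 1 F (f x)) ->
  hasint f (F (2 * pi) - F 0).
Proof.
move=> cf dF; have p0 : 0 < 2 * pi :> R by rewrite mulr_gt0 // pi_gt0.
have cF : continuous F.
  by move=> x; apply: differentiable_continuous; apply/derivable1_diffP; case: (dF x).
split.
  apply: continuous_compact_integrable; first exact: segment_compact.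
  exact: continuous_subspaceT.
rewrite (@continuous_FTC2 _ f F) //.
- exact: continuous_subspaceT.
- split.
  + by move=> x _; case: (dF x).
  + by apply: cvg_at_right_filter; exact: cF.
  + by apply: cvg_at_left_filter; exact: cF.
- by move=> x _; rewrite derive1E; case: (dF x) => _ ->.
Qed.

Lemma hasint_ex (z : R[i]) (j : int) :
  hasint (fun x => complex.Re (z * ex j x)) (if j == 0 then 2 * pi * complex.Re z else 0).
Proof.
case: z => u v; rewrite /ex /expi.
have E x : complex.Re ((u +i* v) * (cos (j%:~R * x) +i* sin (j%:~R * x))) =
    u * cos (j%:~R * x) - v * sin (j%:~R * x) by [].
under eq_fun do rewrite E.
have cf : continuous (fun x : R => u * cos (j%:~R * x) - v * sin (j%:~R * x)).
  move=> x; apply: cvgB; apply: cvgMr.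
    by apply: continuous_comp; [apply: mulrl_continuous|exact: continuous_cos].
  by apply: continuous_comp; [apply: mulrl_continuous|exact: continuous_sin].
have [->|j0] := eqVneq j 0.
  rewrite [complex.Re _]/= (_ : 2 * pi * u = u * (2 * pi) - u * 0); last by ring.
  rewrite (_ : (fun x => _) = (fun=> u)); last first.
    by apply/funext => x; rewrite mul0r cos0 sin0 mulr1 mulr0 subr0.
  apply: (@hasint_ftc (fun=> u) (fun x => u * x)); first by move=> x; exact: cvg_cst.
  move=> x; apply: (is_derive_eq (is_deriveZ u (is_derive_id x 1))).
  by rewrite /GRing.scale /= mulr1.
have jR : j%:~R != 0 :> R by rewrite intr_eq0.
pose F x := (j%:~R)^-1 * (u * sin (j%:~R * x) + v * cos (j%:~R * x)).
rewrite (_ : 0 = F (2 * pi) - F 0).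
  apply: hasint_ftc => // x; rewrite /F.
  by apply: is_derive_eq; rewrite /GRing.scale /=; field.
rewrite /F mulr0 sin0 cos0 !(mulrC j%:~R).
have := expi_2pi R j; rewrite /expi => -[-> ->].
by rewrite subrr.
Qed.

Lemma psum_sqr a L x : cn (psum a L x) ^+ 2 =
  \sum_(l <- zseq L) \sum_(m <- zseq L) complex.Re (a l * conjc (a m) * ex (l - m) x).
Proof.
rewrite -[LHS]/(complex.Re (cn (psum a L x) ^+ 2)%:C) cn_sqrC conjc_psum mulr_suml.
have ReS (s : seq int) (F : int -> R[i]) :
    complex.Re (\sum_(i <- s) F i) = \sum_(i <- s) complex.Re (F i).
  elim: s => [|i s IH]; first by rewrite !big_nil.
  by rewrite !big_cons -IH; case: (F i) => ? ?; case: (\sum_(j <- s) _).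
rewrite ReS; apply: eq_bigr => l _; rewrite mulr_sumr ReS; apply: eq_bigr => m _.
by rewrite exDl mulrACA.
Qed.

Lemma integral_psum_sqr a L :
  hasint (fun x => cn (psum a L x) ^+ 2) (2 * pi * energy a L).
Proof.
have := @hasint_sum _ (zseq L) (fun l x => \sum_(m <- zseq L) complex.Re (a l * conjc (a m) * ex (l - m) x))
  (fun l => \sum_(m <- zseq L) if l - m == 0 then 2 * pi * complex.Re (a l * conjc (a m)) else 0).
move=> /(_ _)/wrap[l|]; first by apply: hasint_sum => m; exact: hasint_ex.
congr (hasint _ _); first by apply/funext => x; rewrite psum_sqr.
rewrite /energy mulr_sumr big_seq [RHS]big_seq; apply: eq_bigr => l lL.
rewrite (big_rem l) // subrr eqxx big_seq big1 => [|m].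
  by rewrite [LHS]addr0 -cn_sqrC.
by rewrite mem_rem_uniq ?uniq_zseq // inE => /andP[ml _]; rewrite subr_eq0 eq_sym (negPf ml).
Qed.

Lemma limn_einf_ub (u : nat -> \bar R) (M : \bar R) : (forall k, (u k <= M)%E) ->
  (limn_einf u <= M)%E.
Proof.
move=> uM; rewrite limn_einf_lim; apply: lime_le; first exact: is_cvg_einfs.
apply: nearW => k; apply: le_trans (uM k).
by apply: ereal_inf_lbound; exists k => //=.
Qed.

(* Fatou's lemma: the square integral of [S_{n_k}] is at most the lower limit
   of those of [S_{n_k} - S_{n_j}], that is, the tail of the energy. *)
Lemma bounded_energy d (n : nat -> nat) A : (forall N, energy d N <= A) ->
  (forall N, exists k0, forall k, (k0 <= k)%N -> (N <= n k)%N) ->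
  (forall x e, 0 < e -> exists k0, forall k, (k0 <= k)%N -> cn (psum d (n k) x) <= e) ->
  forall l, d l = 0.
Proof.
move=> dA noo pd.
pose z := sup [set y | exists N, y = energy d N].
have supE : has_sup [set y | exists N, y = energy d N].
  by split; [exists (energy d 0), 0%N|exists A => _ [N ->]].
have ez N : energy d N <= z by apply: ub_le_sup; [case: supE|exists N].
have tp : 0 < 2 * pi :> R by rewrite mulr_gt0 // pi_gt0.
have main k : energy d (n k) <= z - energy d (n k).
  have [j0 Hj0] := noo (n k).
  pose f i x := cn (psum d (n (j0 + i)%N) x - psum d (n k) x) ^+ 2.
  have hf i : hasint (f i) (2 * pi * (energy d (n (j0 + i)%N) - energy d (n k))).
    have nk : (n k <= n (j0 + i))%N by rewrite Hj0 // leq_addr.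
    have := integral_psum_sqr (fun l => d l - cutoff (n k) d l) (n (j0 + i)%N).
    congr (hasint _ (2 * pi * _)).
      apply/funext => x; rewrite /f -(psum_cutoff _ _ nk) /psum -sumrB.
      by congr (cn _ ^+ 2); apply: eq_bigr => l _; rewrite mulrBl.
    rewrite /energy -[in RHS](sum_cutoff _ nk) -sumrB; apply: eq_bigr => l _.
    by rewrite /cutoff; case: ifP => _; rewrite ?subr0 // !subrr cn0 expr0n.
  have fx x : limn_einf (fun i => (f i x)%:E) = (cn (psum d (n k) x) ^+ 2)%:E.
    apply: (cvg_limn_einf_sup _).1; apply: cvg_EFin; first exact: nearW.
    pose g i := cn (psum d (n (j0 + i)%N) x - psum d (n k) x).
    have gl : g i @[i --> \oo] --> cn (psum d (n k) x); last first.
      rewrite (_ : fine \o _ = (fun i => g i * g i)); last first.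
        by apply/funext => i; rewrite /= /f expr2.
      by rewrite expr2; exact: cvgM.
    apply/cvgrPdist_le => e e0 /=.
    have [i0 Hi0] := pd x e e0; near=> i; rewrite /g.
    rewrite ler_norml.
    have h : cn (psum d (n (j0 + i)%N) x) <= e.
      by apply: Hi0; apply: leq_trans (leq_addl _ _); near: i; exact: nbhs_infty_ge.
    have := cn_dist 0 (psum d (n (j0 + i)%N) x) (psum d (n k) x).
    have := cn_dist (psum d (n (j0 + i)%N) x) (psum d (n k) x) 0.
    rewrite !subr0 !sub0r !cnN [cn (psum d (n k) x - _)]cnB => h1 h2.
    apply/andP; split; lra.
  have := @fatou _ _ _ lebesgue_measure I2pi
    (measurable_itv _) (fun i x => (f i x)%:E) _ _.
  move=> /(_ _ _)/wrap[i|i x _|].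
  - by have [/measurable_int + _] := hf i.
  - by rewrite lee_fin sqr_ge0.
  under [X in (X <= _)%E -> _]eq_integral => x _ do rewrite fx.
  have [_ ->] := integral_psum_sqr d (n k).
  move=> /le_trans/(_ (limn_einf_ub (M := (2 * pi * (z - energy d (n k)))%:E) _)).
  move=> /(_ _)/wrap[i|].
    by have [_ ->] := hf i; rewrite lee_fin ler_pM2l // lerD2r.
  by rewrite lee_fin ler_pM2l.
(* By [main], [2 * energy d (n k) <= z], and [n k] exceeds any given [N]; hence the supremum [z] of
   the energies is at most [z / 2]. *)
have z0 : z <= z / 2.
  apply: ge_sup; first by case: supE.
  move=> _ [N ->]; have [k0 Hk0] := noo N.
  have := energy_mono d (Hk0 k0 (leqnn _)); have := main k0; lra.
move=> l; apply: Normc.eq0_normc; apply/eqP; rewrite -sqrf_eq0 eq_le sqr_ge0 andbT.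
have := ez `|l|%N; rewrite /energy (big_rem l) /=; last by rewrite mem_zseq.
have : 0 <= \sum_(y <- rem l (zseq `|l|)) cn (d y) ^+ 2 by apply: sumr_ge0 => ? _; rewrite sqr_ge0.
lra.
Unshelve. all: by end_near. Qed.

End Energy.

(** * Discretization *)

Section Grid.
Variable R : realType.
Implicit Types (a b d : int -> R[i]) (x y h : R).

Definition gridpt (Q r : nat) : R := 2 * pi * (r%:R / Q%:R).

(** A full geometric sum of a [Q]-th root of unity, which differs from [1] because [Q] does not
    divide [j]. *)
Lemma grid_ex Q (j : int) : (0 < `|j| < Q)%N -> \sum_(r < Q) ex j (gridpt Q r) = 0.
Proof.
move=> /andP[j0 jQ]; have Q0 : 0 < Q%:R :> R by rewrite ltr0n; lia.
pose t : R := 2 * pi * (j%:~R / Q%:R).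
have E (r : nat) : ex j (gridpt Q r) = expi t ^+ r.
  rewrite -exX /ex /gridpt /t; congr expi.
  have -> : r%:Z%:~R = r%:R :> R by [].
  by ring.
under eq_bigr => r _ do rewrite E.
have p0 : 0 < 2 * pi :> R by rewrite mulr_gt0 // pi_gt0.
have [c c0 /(_ t)] := expi_far (divr_gt0 p0 Q0).
move=> /(_ _)/wrap[m|ct].
  rewrite (_ : t - _ = 2 * pi / Q%:R * (j - m * Q%:Z)%:~R); last first.
    by rewrite /t rmorphB rmorphM /=; field; rewrite gt_eqF.
  have pQ := divr_gt0 p0 Q0.
  rewrite normrM gtr0_norm // ler_peMr //; first exact: ltW.
  rewrite -intr_norm -[1]/(1%:~R) ler_int.
  suff : j - m * Q%:Z != 0 by lia.
  apply/eqP => /eqP; rewrite subr_eq0 => /eqP jm; move: j0 jQ; rewrite jm abszM.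
  by have [->|] := eqVneq m 0; [rewrite mul0n|move=> ? _; rewrite -[(_ < Q)%N]negbK -leqNgt; nia].
have ne : expi t - 1 != 0.
  apply/eqP => h; move: ct; rewrite cnB h cn0; lra.
apply: (mulfI ne); rewrite mulr0 -subrX1 -exX /ex.
have -> : Q%:Z%:~R * t = 2 * pi * j%:~R.
  have -> : Q%:Z%:~R = Q%:R :> R by [].
  by rewrite /t; field; rewrite gt_eqF.
by rewrite expi_2pi subrr.
Qed.

(** Parseval's identity on [2 L + 1] equidistant points is exact, since the frequencies [l - m] stay
    within [2 L]. *)
Lemma grid_inner a b L :
  \sum_(r < (2 * L).+1) psum a L (gridpt (2 * L).+1 r) *
                        conjc (psum b L (gridpt (2 * L).+1 r)) =
  ((2 * L).+1)%:R * \sum_(l <- zseq L) a l * conjc (b l).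
Proof.
set Q := (2 * L).+1.
under eq_bigr => r _ do rewrite conjc_psum mulr_suml.
rewrite exchange_big mulr_sumr /= big_seq [RHS]big_seq; apply: eq_bigr => l lL.
under eq_bigr => r _ do rewrite mulr_sumr.
rewrite exchange_big /= (big_rem l) // -[LHS]/(_ + _).
rewrite [X in _ + X]big_seq [X in _ + X]big1 => [|m].
  rewrite addr0; under eq_bigr => r _ do
    rewrite mulrACA -exDl subrr ex0 mulr1.
  by rewrite sumr_const card_ord mulr_natl.
rewrite mem_rem_uniq ?uniq_zseq // inE mem_zseq => /andP[ml mL].
under eq_bigr => r _ do rewrite mulrACA -exDl.
rewrite -mulr_sumr grid_ex ?mulr0 //; move: lL ml mL.
by rewrite mem_zseq /Q; lia.
Qed.

Lemma grid_energy a n L : (n <= L)%N ->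
  \sum_(r < (2 * L).+1) cn (psum a n (gridpt (2 * L).+1 r)) ^+ 2 =
  ((2 * L).+1)%:R * energy a n.
Proof.
move=> nL; apply: complexI; rewrite rmorph_sum /=.
under eq_bigr => r _ do rewrite -(psum_cutoff _ _ nL) [_%:C]cn_sqrC.
rewrite grid_inner rmorphM /= rmorph_nat; congr (_ * _).
rewrite /energy rmorph_sum /= -(sum_cutoff _ nL); apply: eq_bigr => l _.
rewrite /cutoff; case: ifP => _; last by rewrite mul0r.
by rewrite [_%:C]cn_sqrC.
Qed.

(** The first-order term is kept apart: with [|y - x|] of order [n^{-3/2}] and bounded [d], the
    trivial pointwise estimate of it is of order [n^{1/2}], while its mean square is bounded. The
    remainder needs no averaging. *)
Lemma psum_taylor d n x y :
  cn (psum d n x) <= cn (psum d n y)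
    + `|y - x| * cn (psum (fun l => (l%:~R)%:C * d l) n x)
    + \sum_(l <- zseq n) cn (d l) * (2 * (l%:~R * (y - x)) ^+ 2).
Proof.
have E : psum d n y - psum d n x - (0 +i* (y - x)) * psum (fun l => (l%:~R)%:C * d l) n x =
  \sum_(l <- zseq n) d l * ex l x * (expi (l%:~R * (y - x)) - 1 - (0 +i* (l%:~R * (y - x)))).
  rewrite /psum mulr_sumr -!sumrB; apply: eq_bigr => l _.
  have -> : 0 +i* (l%:~R * (y - x)) = (l%:~R)%:C * (0 +i* (y - x)) :> R[i].
    by simpc.
  have -> : ex l y = ex l x * expi (l%:~R * (y - x)) by rewrite -/(ex l _) -exDr addrC subrK.
  by ring.
have h1 : cn (psum d n y - psum d n x - (0 +i* (y - x)) * psum (fun l => (l%:~R)%:C * d l) n x) <=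
    \sum_(l <- zseq n) cn (d l) * (2 * (l%:~R * (y - x)) ^+ 2).
  rewrite E; apply: le_trans (cn_sum _ _) _; apply: ler_sum => l _.
  by rewrite !cnM cn_ex mulr1 ler_wpM2l ?cn_ge0 // expi_taylor.
have h2 : cn ((0 +i* (y - x)) * psum (fun l => (l%:~R)%:C * d l) n x) =
    `|y - x| * cn (psum (fun l => (l%:~R)%:C * d l) n x).
  by rewrite cnM; congr (_ * _); rewrite /= expr0n add0r sqrtr_sqr.
rewrite -h2.
set u := psum d n y in h1 *; set v := psum d n x in h1 *; set w := _ * _ in h1 *.
have -> : v = u - w - (u - v - w) by ring.
apply: le_trans (cn_triB _ _) _; rewrite lerD // -?h2; last first.
  by apply: le_trans (cn_triB _ _) _.
Qed.

Lemma psum_le d n B x : (forall l, cn (d l) <= B) -> cn (psum d n x) <= ((2 * n).+1)%:R * B.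
Proof.
move=> dB; apply: le_trans (cn_sum _ _) _.
apply: (@le_trans _ _ (\sum_(l <- zseq n) B)).
  by apply: ler_sum => l _; rewrite cnM cn_ex mulr1.
by rewrite big_const_seq count_predT size_map size_iota subn0 iter_addr_0 mulr_natl.
Qed.

Lemma sum_zseq_const n (B : R) (f : int -> R) :
  (forall l, (`|l| <= n)%N -> f l <= B) ->
  \sum_(l <- zseq n) f l <= ((2 * n).+1)%:R * B.
Proof.
move=> fB; apply: (@le_trans _ _ (\sum_(l <- zseq n) B)).
  by rewrite big_seq [leRHS]big_seq; apply: ler_sum => l; rewrite mem_zseq => /fB.
by rewrite big_const_seq count_predT size_map size_iota subn0 iter_addr_0 mulr_natl.
Qed.

Lemma tail_inv_sqr (N L : nat) : (0 < N)%N -> (N <= L)%N ->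
  \sum_(l <- zseq L) (if (N < `|l|)%N then (((absz l)%:R) ^+ 2)^-1 else 0) <=
  2 / N%:R - 2 / L%:R :> R.
Proof.
move=> N0; elim: L => [|L IH]; first by lia.
rewrite leq_eqVlt => /orP[/eqP <-|NL].
  rewrite subrr big_seq big1 // => l; rewrite mem_zseq => lN.
  by rewrite ltnNge lN.
rewrite zseq_ind abszN NL addrA; apply: le_trans (lerD (lexx _) (IH NL)) _.
have L0 : 0 < L%:R :> R by rewrite ltr0n; lia.
have -> : absz L.+1%:Z = L.+1 by [].
rewrite -natr1; set x : R := L%:R in L0 *.
have h : ((x + 1) ^+ 2)^-1 <= x^-1 - (x + 1)^-1.
  have -> : x^-1 - (x + 1)^-1 = (x * (x + 1))^-1 by field; rewrite !gt_eqF //; lra.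
  rewrite lef_pV2 ?posrE; first by nra.
    by rewrite exprn_gt0 //; lra.
  by rewrite mulr_gt0 //; lra.
move: h; move: x^-1 (x + 1)^-1 ((x + 1) ^+ 2)^-1 (N%:R)^-1 => u v w q; lra.
Qed.

(** Uniformity in [x] matters: the degree [L] determines the grid, so it has to be chosen before the
    points. *)
Lemma psum_tail a M (e : R) : summ_by a M -> 0 < e -> exists N, forall L x, (N <= L)%N ->
  cn (psum a L x - tot (fun l => a l * ex l x)) <= e.
Proof.
move=> aM e0; have e20 : 0 < e / 2 by rewrite divr_gt0.
have [s0 tl] := summ_by_tail aM e20; have [N sN] := zseq_exhaust s0.
exists N => L x NL.
have S : summ_by (fun l => a l * ex l x) M.
  by apply: summ_by_le aM => l; rewrite cnM cn_ex mulr1.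
have [N' HN'] := has_tot_zseq (summ_by_tot S) e20.
have {}HN' := HN' (maxn L N') (leq_maxr _ _).
apply: le_trans (cn_dist (psum a (maxn L N') x) _ _) _.
rewrite (splitr e) lerD // cnB.
have -> : psum a (maxn L N') x - psum a L x =
    \sum_(l <- [seq l <- zseq (maxn L N') | ~~ (`|l| <= L)%N]) a l * ex l x.
  rewrite /psum -(sum_cutoff _ (leq_maxl L N')) -sumrB big_filter [RHS]big_mkcond /=.
  by apply: eq_bigr => l _; case: ifP => _; rewrite ?subrr ?subr0.
apply: le_trans (cn_sum _ _) _.
apply: (@le_trans _ _ (\sum_(l <- [seq l <- zseq (maxn L N') | ~~ (`|l| <= L)%N]) cn (a l))).
  by apply: ler_sum => l _; rewrite cnM cn_ex mulr1.
apply: tl; first by rewrite filter_uniq ?uniq_zseq.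
move=> l; rewrite mem_filter => /andP[lL _]; apply/negP => /sN; rewrite mem_zseq; lia.
Qed.

End Grid.

(** * Growth of the energy *)

Section EnergyStep.
Variable R : realType.
Implicit Types (d : int -> R[i]) (x y h : R).

Lemma sqr_sum3 (u v w : R) : (u + v + w) ^+ 2 <= 3 * (u ^+ 2 + v ^+ 2 + w ^+ 2).
Proof. by have := sqr_ge0 (u - v); have := sqr_ge0 (v - w); have := sqr_ge0 (u - w); nra. Qed.

(* Taylor's formula gives [|S_n| <= C + 4 h |S_n'| + O(1)], and the mean square
   of [h S_n'] is [O(1)] by [deriv_energy], since [h = n^{-3/2}]. *)
Lemma near_sqr d (B C h x y : R) (n : nat) : (forall l, cn (d l) <= B) -> (0 < n)%N ->
  h ^+ 2 * n%:R ^+ 3 = 1 -> `|x - y| <= 4 * h -> cn (psum d n y) <= C ->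
  cn (psum d n x) ^+ 2 <= 3 * (C ^+ 2 +
    16 * h ^+ 2 * cn (psum (fun l => (l%:~R)%:C * d l) n x) ^+ 2 + (96 * B) ^+ 2).
Proof.
move=> dB n0 hn xy SC; have B0 : 0 <= B by exact: le_trans (cn_ge0 _) (dB 0).
have n1 : 1 <= n%:R :> R by rewrite ler1n.
set D := cn (psum (fun l => (l%:~R)%:C * d l) n x).
have D0 : 0 <= D by exact: cn_ge0.
have xy2 : (y - x) ^+ 2 <= 16 * h ^+ 2.
  rewrite -(real_normK (num_real (y - x))) distrC (_ : 16 * h ^+ 2 = (4 * h) ^+ 2); last by ring.
  by rewrite lerXn2r ?nnegrE // (le_trans (normr_ge0 _) xy).
(* [96 = 3 * 32]: there are [2 n + 1 <= 3 n] terms, each at most [B * 2 * n^2 * 16 h^2]. *)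
have T : \sum_(l <- zseq n) cn (d l) * (2 * (l%:~R * (y - x)) ^+ 2) <= 96 * B.
  apply: (@le_trans _ _ (((2 * n).+1)%:R * (B * (32 * (n%:R ^+ 2 * h ^+ 2))))).
    apply: sum_zseq_const => l ln; apply: ler_pM => //; first exact: cn_ge0.
      by rewrite mulr_ge0 // sqr_ge0.
    have : (l%:~R : R) ^+ 2 <= n%:R ^+ 2.
      rewrite -(real_normK (num_real (l%:~R : R))) -intr_norm.
      have -> : (`|l|%R%:~R = (absz l)%:R :> R) by rewrite natr_absz.
      by rewrite lerXn2r ?nnegrE // ler_nat.
    move=> hl; rewrite exprMn.
    have := ler_pM (sqr_ge0 _) (sqr_ge0 _) hl xy2; lra.
  have -> : ((2 * n).+1)%:R = 2 * n%:R + 1 :> R by rewrite -natr1 natrM.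
  apply: (@le_trans _ _ ((3 * n%:R) * (B * (32 * (n%:R ^+ 2 * h ^+ 2))))).
    apply: ler_wpM2r; last by lra.
    by rewrite !(sqr_ge0, mulr_ge0).
  have -> : 3 * n%:R * (B * (32 * (n%:R ^+ 2 * h ^+ 2))) = 96 * B * (h ^+ 2 * n%:R ^+ 3).
    by ring.
  by rewrite hn mulr1.
have := psum_taylor d n x y; rewrite -/D => H.
have {}H : cn (psum d n x) <= C + 4 * h * D + 96 * B.
  apply: le_trans H _; rewrite !lerD // ler_wpM2r // distrC //.
apply: (@le_trans _ _ ((C + 4 * h * D + 96 * B) ^+ 2)).
  by rewrite lerXn2r ?nnegrE ?cn_ge0 // (le_trans (cn_ge0 _) H).
by apply: le_trans (sqr_sum3 _ _ _) _; rewrite (_ : (4 * h * D) ^+ 2 = 16 * h ^+ 2 * D ^+ 2) //; ring.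
Qed.

Lemma deriv_energy d (B h : R) (n : nat) : (forall l, cn (d l) <= B) -> (0 < n)%N ->
  h ^+ 2 * n%:R ^+ 3 = 1 ->
  16 * h ^+ 2 * energy (fun l => (l%:~R)%:C * d l) n <= 48 * B ^+ 2.
Proof.
move=> dB n0 hn; have B0 : 0 <= B by exact: le_trans (cn_ge0 _) (dB 0).
have n1 : 1 <= n%:R :> R by rewrite ler1n.
have : energy (fun l => (l%:~R)%:C * d l) n <= ((2 * n).+1)%:R * (n%:R ^+ 2 * B ^+ 2).
  apply: sum_zseq_const => l ln; rewrite cnM exprMn cn_real.
  apply: ler_pM; rewrite ?sqr_ge0 ?lerXn2r ?nnegrE ?cn_ge0 //.
  rewrite -intr_norm.
  have -> : (`|l|%R%:~R = (absz l)%:R :> R) by rewrite natr_absz.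
  by rewrite ler_nat.
have -> : ((2 * n).+1)%:R = 2 * n%:R + 1 :> R by rewrite -natr1 natrM.
move=> H; apply: (@le_trans _ _ (16 * h ^+ 2 * (3 * n%:R * (n%:R ^+ 2 * B ^+ 2)))).
  apply: ler_wpM2l; first by rewrite !(sqr_ge0, mulr_ge0).
  apply: le_trans H _; apply: ler_wpM2r; first by rewrite !(sqr_ge0, mulr_ge0).
  lra.
have -> : 16 * h ^+ 2 * (3 * n%:R * (n%:R ^+ 2 * B ^+ 2)) =
    48 * B ^+ 2 * (h ^+ 2 * n%:R ^+ 3) by ring.
by rewrite hn mulr1.
Qed.

(** Beyond [N] the decay of the spline gives [spl^2 <= (|l| h)^{-8} = n^{12} / |l|^8 <= N^7 / |l|^8
    <= N / |l|^2], and these sum to at most [2]. *)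
Lemma smooth_energy d (B h : R) (n N L : nat) : (forall l, cn (d l) <= B) ->
  (0 < n)%N -> (n ^ 12 <= N ^ 7)%N -> (N <= L)%N -> h ^+ 2 * n%:R ^+ 3 = 1 ->
  energy (fun l => d l * (spl h l)%:C) L <= energy d N + 2 * B ^+ 2.
Proof.
move=> dB n0 nN NL hn; have B0 : 0 <= B by exact: le_trans (cn_ge0 _) (dB 0).
have N0 : (0 < N)%N by case: N nN {NL} => //; rewrite exp0n // leqn0 expn_eq0; lia.
have NR : 0 < N%:R :> R by rewrite ltr0n.
have h8 : (h ^+ 8)^-1 = n%:R ^+ 12.
  have : (h ^+ 2 * n%:R ^+ 3) ^+ 4 = 1 by rewrite hn expr1n.
  rewrite exprMn -!exprM => e; apply: (mulfI (x := h ^+ 8)).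
    by apply/eqP => h0; move: e; rewrite h0 mul0r => /eqP; rewrite eq_sym oner_eq0.
  rewrite e divff //.
  by apply/eqP => h0; move: e; rewrite h0 mul0r => /eqP; rewrite eq_sym oner_eq0.
have term l : cn (d l * (spl h l)%:C) ^+ 2 <=
    (if (`|l| <= N)%N then cn (d l) ^+ 2 else 0) +
    B ^+ 2 * (N%:R * (if (N < `|l|)%N then (((absz l)%:R) ^+ 2)^-1 else 0)).
  rewrite cnM cn_real (ger0_norm (spl_ge0 _ _)) exprMn.
  have s0 := spl_ge0 h l; have s1 := spl_le1 h l.
  case: (leqP `|l| N) => lN.
    rewrite !mulr0 addr0 ler_piMr ?sqr_ge0 //.
    by rewrite expr_le1.
  rewrite add0r; apply: ler_pM; rewrite ?sqr_ge0 ?lerXn2r ?nnegrE ?cn_ge0 //.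
  set q : R := (absz l)%:R; have q0 : 0 < q by rewrite ltr0n; lia.
  have Nq : N%:R <= q by rewrite ler_nat ltnW.
  have q8 : 0 < q ^+ 8 by rewrite exprn_gt0.
  have hs : spl h l ^+ 2 * (q ^+ 8 * h ^+ 8) <= 1.
    have := spl_decay h l; rewrite -intr_norm.
    have -> : (`|l|%R%:~R = q) by rewrite /q natr_absz.
    move=> hs; have -> : q ^+ 8 * h ^+ 8 = ((q * `|h|) ^+ 4) ^+ 2.
      rewrite -exprM exprMn; congr (_ * _).
      by rewrite (exprM `|h| 2 4) real_normK ?num_real // -exprM.
    rewrite -exprMn expr_le1 // mulr_ge0 // exprn_ge0 // mulr_ge0 // ltW //.
  have h80 : 0 < h ^+ 8.
    by rewrite -invr_gt0 h8 exprn_gt0 // ltr0n.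
  have {}hs : spl h l ^+ 2 * q ^+ 8 <= n%:R ^+ 12.
    by rewrite -h8 -[leRHS]mul1r ler_pdivlMr // -mulrA.
  have nNR : n%:R ^+ 12 <= N%:R ^+ 7 :> R by rewrite -!natrX ler_nat.
  have NqR : N%:R ^+ 6 <= q ^+ 6 by rewrite lerXn2r ?nnegrE // ltW.
  rewrite ler_pdivlMr ?exprn_gt0 // -(ler_pM2r (exprn_gt0 6 q0)) -mulrA -exprD.
  apply: le_trans hs (le_trans nNR _); rewrite (exprS _ 6).
  by rewrite ler_pM2l.
apply: (@le_trans _ _ (\sum_(l <- zseq L) ((if (`|l| <= N)%N then cn (d l) ^+ 2 else 0) +
    B ^+ 2 * (N%:R * (if (N < `|l|)%N then (((absz l)%:R) ^+ 2)^-1 else 0))))).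
  by apply: ler_sum => l _; exact: term.
rewrite big_split /= sum_cutoff // lerD2l -!mulr_sumr mulrC.
rewrite ler_wpM2r ?sqr_ge0 //.
apply: le_trans (ler_wpM2l (ltW NR) (tail_inv_sqr R N0 NL)) _.
rewrite mulrBr mulrCA divff ?gt_eqF // mulr1 gerBl.
by rewrite mulr_ge0 ?divr_ge0 // ltW.
Qed.

Lemma energy_step d (K : set R) (B C : R) (n N : nat) :
  (forall l, cn (d l) <= B) -> (0 < n)%N -> (n ^ 12 <= N ^ 7)%N ->
  (forall y, K y -> cn (psum d n y) <= C) ->
  (forall y h, 0 < h -> (forall z, K z -> 4 * h < `|z - y|) ->
     pairing d (spline h y) = 0) ->
  32 <= energy d n ->
  energy d n ^+ 2 <= 1024 * (3 * (C ^+ 2 + 48 * B ^+ 2 + (96 * B) ^+ 2) + 1)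
    * (energy d N + 2 * B ^+ 2).
Proof.
move=> dB n0 nN KC van E32.
have B0 : 0 <= B by exact: le_trans (cn_ge0 _) (dB 0).
have n1 : 1 <= n%:R :> R by rewrite ler1n.
pose h : R := (n%:R * Num.sqrt n%:R)^-1.
have sn : 1 <= Num.sqrt n%:R :> R by rewrite -[leLHS]sqrtr1 ler_wsqrtr.
have h0 : 0 < h by rewrite invr_gt0 mulr_gt0 //; lra.
have hn : h ^+ 2 * n%:R ^+ 3 = 1.
  rewrite /h exprVn exprMn sqr_sqrtr; last by lra.
  by rewrite -exprSr mulVf // expf_neq0 // gt_eqF //; lra.
have hn1 : n%:R * h <= 1.
  rewrite /h invfM mulrA divff ?mul1r; last by rewrite gt_eqF //; lra.
  by rewrite invf_le1 //; lra.
pose b l := d l * (spl h l)%:C.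
have [M HM] := test_summ (spline_test 0 h0).
have bM : summ_by b (B * M).
  have := summ_bounded dB HM; congr (summ_by _ _); apply/funext => l.
  by rewrite /b /spline exr0 mulr1 mulrC.
pose P : R := ((2 * n).+1)%:R * B; have P0 : 0 <= P by rewrite mulr_ge0.
(* The truncation tolerance is matched to the bound [P] on [|S_n|]: wherever [g] vanishes, the
   product of [S_n] with the truncated [g] is at most [1]. *)
have e0 : 0 < (P + 1)^-1 by rewrite invr_gt0; lra.
have [L0 HL0] := psum_tail bM e0.
pose L := maxn (maxn n N) L0.
have nL : (n <= L)%N by rewrite /L; lia.
have NL : (N <= L)%N by rewrite /L; lia.
have {HL0} GL x : cn (psum b L x - pairing d (spline h x)) <= (P + 1)^-1.
  have := HL0 L x (leq_maxr _ _); congr (cn (_ - tot _) <= _).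
  by apply/funext => l; rewrite /b /spline mulrA.
pose Q := (2 * L).+1; pose pt (r : 'I_Q) : R := gridpt R Q r.
have Q0 : 0 < Q%:R :> R by rewrite ltr0n.
set X := 3 * (C ^+ 2 + 48 * B ^+ 2 + (96 * B) ^+ 2) + 1.
have X0 : 0 < X.
  by rewrite /X; have := sqr_ge0 C; have := sqr_ge0 B; have := sqr_ge0 (96 * B); lra.
set Y := energy d N + 2 * B ^+ 2.
pose E := energy d n.
(* For [|l| <= n] one has [|l| h <= 1], so [sinc(lh)] is at least [1/2] and the pairing of [S_n]
   with [g] keeps at least [1/16] of the energy. *)
have low : Q%:R * (E / 16) <= \sum_(r < Q) cn (psum d n (pt r)) * cn (psum b L (pt r)).
  have G := grid_inner (cutoff n d) b L; rewrite -/Q in G.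
  have : cn (Q%:R * \sum_(l <- zseq L) cutoff n d l * conjc (b l)) <=
      \sum_(r < Q) cn (psum d n (pt r)) * cn (psum b L (pt r)).
    rewrite -G; apply: le_trans (cn_sum _ _) _; apply: ler_sum => r _.
    rewrite cnM psum_cutoff // ler_wpM2l ?cn_ge0 //.
    by case: (psum b L _) => u v /=; rewrite sqrrN.
  apply: le_trans; rewrite cnM.
  have -> : cn (Q%:R : R[i]) = Q%:R by rewrite -[Q%:R in LHS]/(1 *+ Q) normcMn Normc.normc1.
  rewrite ler_pM2l //; apply: le_trans (cn_Re _); apply: le_trans (ler_norm _).
  have -> : \sum_(l <- zseq L) cutoff n d l * conjc (b l) =
      (\sum_(l <- zseq n) cn (d l) ^+ 2 * spl h l)%:C.
    rewrite rmorph_sum -(sum_cutoff _ nL) /=; apply: eq_bigr => l _.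
    rewrite /cutoff; case: ifP => _; last by rewrite mul0r.
    by rewrite /b conjcM mulrA -cn_sqrC -[conjc _%:C]/((spl h l) -i* 0) oppr0 -rmorphM.
  rewrite /= /E /energy mulr_suml big_seq [leRHS]big_seq; apply: ler_sum => l.
  rewrite mem_zseq => ln; rewrite ler_wpM2l ?sqr_ge0 //.
  have : 1 / 2 <= sinc (l%:~R * h).
    apply: sinc_ge_half; rewrite normrM (gtr0_norm h0) -intr_norm.
    have -> : (`|l|%R%:~R = (absz l)%:R :> R) by rewrite natr_absz.
    by apply: le_trans hn1; rewrite ler_pM2r // ler_nat.
  rewrite /spl => hs; have : (1 / 2) ^+ 4 <= sinc (l%:~R * h) ^+ 4.
    by rewrite lerXn2r ?nnegrE //; lra.
  lra.
(* Cauchy-Schwarz with a free parameter [mu]: the bound is proved at each grid point separately,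
   near [K] or not, and then summed over the whole grid. *)
have up (mu : R) : 0 < mu -> E / 16 <= 1 + (mu * X + Y / mu) / 2.
  move=> mu0; rewrite -(ler_pM2l Q0); apply: le_trans low _.
  pose D (r : 'I_Q) := cn (psum (fun l => (l%:~R)%:C * d l) n (pt r)).
  pose T := (96 * B) ^+ 2; pose D2 := energy (fun l => (l%:~R)%:C * d l) n.
  pose al := mu * 3 * (16 * h ^+ 2) / 2; pose A := 1 + mu * (3 * (C ^+ 2 + T)) / 2.
  apply: (@le_trans _ _ (\sum_(r < Q) (A + al * D r ^+ 2
     + (2 * mu)^-1 * cn (psum b L (pt r)) ^+ 2))).
    apply: ler_sum => r _.
    set s := cn (psum d n (pt r)); set g := cn (psum b L (pt r)).
    have s0 : 0 <= s by exact: cn_ge0.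
    have g0 : 0 <= g by exact: cn_ge0.
    have gm0 : 0 <= g ^+ 2 / mu by rewrite divr_ge0 ?sqr_ge0 // ltW.
    have V0 : 0 <= 3 * (C ^+ 2 + 16 * h ^+ 2 * D r ^+ 2 + T).
      by rewrite !(sqr_ge0, mulr_ge0, addr_ge0).
    have -> : A + al * D r ^+ 2 + (2 * mu)^-1 * g ^+ 2 =
        1 + (mu * (3 * (C ^+ 2 + 16 * h ^+ 2 * D r ^+ 2 + T)) + g ^+ 2 / mu) / 2.
      by rewrite /A /al; field; rewrite gt_eqF.
    case: (pselect (exists2 y, K y & `|pt r - y| <= 4 * h)) => [[y Ky xy]|far_r].
      have := near_sqr dB n0 hn xy (KC y Ky); rewrite -/(D r) -/s -/T => sV.
      (* AM-GM: [2 s g <= mu s^2 + g^2 / mu] *)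
      have am : s * g <= (mu * s ^+ 2 + g ^+ 2 / mu) / 2.
        have := sqr_ge0 (mu * s - g) => sq.
        have : 0 <= (mu * s - g) ^+ 2 / mu by rewrite divr_ge0 // ltW.
        rewrite (_ : (mu * s - g) ^+ 2 / mu = mu * s ^+ 2 - 2 * (s * g) + g ^+ 2 / mu); first by lra.
        by field; rewrite gt_eqF.
      apply: le_trans am _; have := ler_wpM2l (ltW mu0) sV; lra.
    have ge : g <= (P + 1)^-1.
      have := GL (pt r); rewrite (van _ _ h0) ?subr0 // => z Kz.
      rewrite ltNge; apply/negP => hz; apply: far_r; exists z => //.
      by rewrite distrC.
    have sP : s <= P by exact: psum_le.
    have : s * g <= 1.
      apply: le_trans (ler_pM s0 g0 sP ge) _.
      by rewrite ler_pdivrMr ?mul1r; lra.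
    have := mulr_ge0 (ltW mu0) V0; lra.
  have G1 := grid_energy d nL; have G2 := grid_energy b (leqnn L).
  have G3 := grid_energy (fun l => (l%:~R)%:C * d l) nL.
  rewrite -/Q in G1 G2 G3.
  have -> : \sum_(r < Q) (A + al * D r ^+ 2 + (2 * mu)^-1 * cn (psum b L (pt r)) ^+ 2) =
      Q%:R * A + al * (Q%:R * D2) + (2 * mu)^-1 * (Q%:R * energy b L).
    rewrite big_split /= -[X in _ + X]mulr_sumr G2 big_split /= -mulr_sumr G3.
    by rewrite sumr_const card_ord [Q%:R * A]mulr_natl.
  have Db := deriv_energy dB n0 hn.
  have Yb := smooth_energy dB n0 nN NL hn.
  rewrite -/b -/Y in Yb; rewrite -/D2 in Db.
  have -> : Q%:R * A + al * (Q%:R * D2) + (2 * mu)^-1 * (Q%:R * energy b L) =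
      Q%:R * (A + al * D2 + (2 * mu)^-1 * energy b L) by ring.
  rewrite ler_pM2l //.
  have h1 : (2 * mu)^-1 * energy b L <= Y / mu / 2.
    rewrite (_ : Y / mu / 2 = (2 * mu)^-1 * Y); last by field; rewrite gt_eqF.
    by rewrite ler_pM2l // invr_gt0 mulr_gt0.
  have h2 : al * D2 <= mu * (3 * (48 * B ^+ 2)) / 2.
    have := ler_wpM2l (ltW mu0) Db; rewrite /al; lra.
  have : A + mu * (3 * (48 * B ^+ 2)) / 2 <= 1 + mu * X / 2.
    by rewrite /A /X /T; lra.
  lra.
pose Z := E / 16 - 1.
have Z1 : 1 <= Z by rewrite /Z /E; lra.
have ZXY : Z ^+ 2 <= X * Y.
  (* The choice [mu = Z / X] makes [mu X = Z] and [Y / mu = X Y / Z], so [up] becomes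
     [Z <= X Y / Z]. *)
  have mu0 : 0 < Z / X by rewrite divr_gt0 //; lra.
  have := up _ mu0; rewrite mulrAC -mulrA divff ?gt_eqF // mulr1 invf_div.
  move=> hu; have : Z <= Y * (X / Z) by rewrite /Z in hu *; lra.
  rewrite mulrA ler_pdivlMr; last by lra.
  by rewrite -expr2 mulrC.
(* [E >= 32] gives [E / 16 - 1 >= E / 32], and [1024 = 32^2]. *)
have : (E / 32) ^+ 2 <= Z ^+ 2 by rewrite lerXn2r ?nnegrE; rewrite /Z /E; lra.
rewrite -/E -mulrA; move: ZXY; rewrite exprMn; lra.
Qed.

End EnergyStep.

(** * Iteration of the energy inequality *)

Section Iteration.
Variable R : realType.

(** Bernoulli's inequality for [(14 / 13)^i], cleared of denominators. *)
Lemma bernoulli_13_14 i : (13 ^ i * (13 + i) <= 13 * 14 ^ i)%N.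
Proof. by elim: i => // i IH; rewrite !expnS; nia. Qed.

(** After [i] steps [2^(2^i) <= D n_j] and [n_j^(7^i) <= m^(13^i)]; raising the former to the power
    [7^i] contradicts this inequality. *)
Lemma doubly_exponential_growth (D m : nat) :
  exists i, (D ^ (7 ^ i) * m ^ (13 ^ i) < 2 ^ (14 ^ i))%N.
Proof.
(* [D m + 1 <= 2^s], and [i = 13 s] makes Bernoulli's inequality read [(1 + s) 13^i <= 14^i]. *)
pose s := (D * m).+1; exists (13 * s)%N; set i := (13 * s)%N.
have h1 : (D ^ 7 ^ i * m ^ 13 ^ i <= (D * m).+1 ^ 13 ^ i)%N.
  have [->|D0] := posnP D; first by rewrite exp0n ?expn_gt0.
  apply: (@leq_trans ((D * m) ^ 13 ^ i)); last by rewrite leq_exp2r ?expn_gt0.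
  by rewrite expnMn leq_mul2r leq_pexp2l ?orbT // leq_exp2r.
apply: leq_ltn_trans h1 _; apply: (@leq_ltn_trans ((2 ^ s) ^ 13 ^ i)).
  by rewrite leq_exp2r ?expn_gt0 // ltnW // ltn_expl.
rewrite -expnM ltn_exp2l //.
have := bernoulli_13_14 i; have : (0 < 13 ^ i)%N by rewrite expn_gt0.
rewrite {3}/i; move: (13 ^ i)%N (14 ^ i)%N => x y; nia.
Qed.

Lemma energy_bounded (a : nat -> R) (n : nat -> nat) (B C1 C2 : R) :
  (forall N N', (N <= N')%N -> a N <= a N') ->
  (forall N, a N <= ((2 * N).+1)%:R * B) ->
  (forall N, exists k0, forall k, (k0 <= k)%N -> (N <= n k)%N) ->
  (exists k1, forall k, (k1 <= k)%N -> (n k.+1 ^ 12 <= n k ^ 13)%N) ->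
  1 <= C1 -> 0 <= C2 ->
  (forall k N, (0 < n k)%N -> (n k ^ 12 <= N ^ 7)%N -> 32 <= a (n k) ->
     a (n k) ^+ 2 <= C1 * (a N + C2)) ->
  exists A, forall N, a N <= A.
Proof.
move=> amono aB noo [k1 Hk1] C11 C20 step.
(* The three terms meet three needs: [32] opens the hypothesis of [step], [4 C1] gives [u >= 2]
   below, and with [C2] the additive constant [C1 C2] is at most half of [a(n k)^2]. *)
pose A := 32 + 4 * C1 + C2; exists A => N0; rewrite leNgt; apply/negP => aN0.
have [k2 Hk2] := noo (maxn N0 2).
have n2 k : (k2 <= k)%N -> (2 <= n k)%N by move=> /Hk2; rewrite geq_max => /andP[].
pose k0 := maxn k1 k2.
(* [j] is the first index from [k] on with [n_k^12 <= n_j^7]. Its predecessor violates this, so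
   [n_j^84 <= n_{j-1}^91 <= n_k^156], which is the upper bound. Since [n_k >= 2], the index [k]
   itself does not qualify. *)
have next k : (k0 <= k)%N -> exists j, [/\ (k0 <= j)%N, (n k ^ 12 <= n j ^ 7)%N &
    (n j ^ 7 <= n k ^ 13)%N].
  move=> kk; have k2k : (k2 <= k)%N by move: kk; rewrite /k0; lia.
  have ex : exists i, (n k ^ 12 <= n (k + i) ^ 7)%N.
    have [k3 Hk3] := noo (n k ^ 12)%N; exists k3.
    apply: leq_trans (Hk3 (k + k3)%N (leq_addl _ _)) _.
    have := n2 (k + k3)%N (leq_trans k2k (leq_addr _ _)).
    by rewrite -{2}[n (k + k3)%N]expn1 => h; rewrite leq_pexp2l //; lia.
  case: (ex_minnP ex) => -[|i] Hi Hmin.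
    move: Hi; rewrite addn0 leq_exp2l //; exact: n2.
  exists (k + i.+1)%N; split; [by move: kk; rewrite /k0; lia|exact: Hi|].
  have lt : (n (k + i) ^ 7 <= n k ^ 12)%N.
    by rewrite leqNgt; apply/negP => h; have := Hmin i (ltnW h); rewrite ltnn.
  have g : (n (k + i).+1 ^ 12 <= n (k + i) ^ 13)%N by apply: Hk1; move: kk; rewrite /k0; lia.
  rewrite addnS -(@leq_exp2r _ _ 12) // -!expnM.
  have -> : (n (k + i).+1 ^ (7 * 12) = (n (k + i).+1 ^ 12) ^ 7)%N by rewrite -expnM.
  apply: (@leq_trans ((n (k + i) ^ 13) ^ 7)); first by rewrite leq_exp2r.
  have -> : ((n (k + i) ^ 13) ^ 7 = (n (k + i) ^ 7) ^ 13)%N by rewrite -!expnM.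
  apply: (@leq_trans ((n k ^ 12) ^ 13)); first by rewrite leq_exp2r.
  by rewrite -expnM.
have a0 k : (k0 <= k)%N -> A <= a (n k).
  move=> kk; apply: le_trans (ltW aN0) (amono _ _ _).
  have : (k2 <= k)%N by move: kk; rewrite /k0; lia.
  by move=> /Hk2; rewrite geq_max => /andP[].
(* This normalization turns the energy inequality into [u_k^2 <= u_j], free of constants. *)
pose u k := a (n k) / (2 * C1).
have C0 : 0 < 2 * C1 by lra.
have u2 k : (k0 <= k)%N -> 2 <= u k.
  by move=> /a0 h; rewrite /u ler_pdivlMr //; rewrite /A in h; lra.
have sq k : (k0 <= k)%N -> exists j, [/\ (k0 <= j)%N, (n j ^ 7 <= n k ^ 13)%N & u k ^+ 2 <= u j].
  move=> kk; have [j [kj h1 h2]] := next k kk; exists j; split=> //.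
  have ak := a0 k kk; rewrite /A in ak.
  have nk0 : (0 < n k)%N by rewrite (leq_trans _ (n2 _ _)) //; move: kk; rewrite /k0; lia.
  have := step k (n j) nk0 h1; move=> /(_ _)/wrap[|st]; first by lra.
  rewrite /u expr_div_n ler_pdivlMr // mulrAC ler_pdivrMr ?exprn_gt0 //.
  have : 2 * (C1 * C2) <= a (n k) ^+ 2 by nra.
  have : a (n k) ^+ 2 <= 2 * C1 * a (n j) -> a (n k) ^+ 2 * (2 * C1) <= a (n j) * (2 * C1) ^+ 2 by nra.
  move=> h3 h4; apply: h3; lra.
have iter_ i : exists j, [/\ (k0 <= j)%N, (n j ^ (7 ^ i) <= n k0 ^ (13 ^ i))%N &
    2 ^+ (2 ^ i)%N <= u j].
  elim: i => [|i [j [kj h1 h2]]].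
    by exists k0; split; rewrite ?expr1 ?u2.
  have [j' [kj' h3 h4]] := sq j kj; exists j'; split=> //.
    rewrite !expnS !expnM; apply: (@leq_trans ((n j ^ 13) ^ 7 ^ i)).
      by rewrite leq_exp2r ?expn_gt0.
    by rewrite -expnM mulnC expnM -[leqRHS]expnM mulnC expnM leq_exp2r.
  apply: le_trans h4; rewrite expnS mulnC exprM lerXn2r ?nnegrE //.
  by have := u2 j kj; lra.
pose D := (Num.truncn (3 * B / (2 * C1))).+1.
have uD k : (k0 <= k)%N -> u k <= (D * n k)%:R.
  move=> kk; have n1 : 1 <= (n k)%:R :> R.
    by rewrite ler1n (leq_trans _ (n2 _ _)) //; move: kk; rewrite /k0; lia.
  have hD : 3 * B / (2 * C1) <= D%:R by apply: ltW; apply: truncnS_gt; rewrite num_real.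
  have aD := aB (n k); have := a0 k kk; rewrite /A => aA.
  have B0 : 0 <= B.
    have : 0 <= ((2 * n k).+1)%:R * B by lra.
    by rewrite pmulr_rge0.
  rewrite /u natrM; apply: (@le_trans _ _ (3 * B / (2 * C1) * (n k)%:R)); last first.
    by rewrite ler_wpM2r.
  rewrite mulrAC ler_pM2r ?invr_gt0 //; apply: le_trans aD _.
  have -> : ((2 * n k).+1)%:R = 2 * (n k)%:R + 1 :> R by rewrite -natr1 natrM.
  nra.
have [i Hi] := doubly_exponential_growth D (n k0).
have [j [kj h1 h2]] := iter_ i.
have : (2 ^ 2 ^ i <= D * n j)%N.
  by rewrite -(ler_nat R) natrX; exact: le_trans h2 (uD j kj).
have E : (2 ^ i * 7 ^ i = 14 ^ i)%N by rewrite -expnMn.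
rewrite -(@leq_exp2r _ _ (7 ^ i)) ?expn_gt0 // -expnM E (expnMn D).
move=> h; move: Hi; rewrite ltnNge => /negP; apply.
by apply: leq_trans h _; rewrite leq_mul2l h1 orbT.
Qed.

End Iteration.

Section Main.
Variable R : realType.

Lemma expn_le_of_ln (p q a b : nat) : (0 < p)%N -> (0 < q)%N ->
  a%:R * ln (p%:R : R) <= b%:R * ln (q%:R : R) -> (p ^ a <= q ^ b)%N.
Proof.
move=> p0 q0 H; rewrite -(ler_nat R) !natrX -ler_ln ?posrE ?exprn_gt0 ?ltr0n //.
by rewrite !lnXn ?ltr0n //; move: H; rewrite !mulr_natl.
Qed.

End Main.

Theorem theorem2 (R : realType) (c : int -> R[i]) (n : nat -> nat)
  (c_to0 : (c l : R[i]^o) @[l --> absz_infty] --> (0 : R[i]^o))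
  (n_gt0 : forall k : nat, (1 <= k)%N -> (0 < n k)%N)
  (n_oo : n k @[k --> \oo] --> \oo)
  (psum_to0 : forall x : R, 0 <= x <= 2 * pi ->
     (trig_psum c (n k) x : R[i]^o) @[k --> \oo] --> (0 : R[i]^o))
  (n_growth : (ln (n k.+1)%:R / ln (n k)%:R : R) @[k --> \oo] --> (1 : R)) :
  forall l : int, c l = 0.
Proof.
have normE (z : R[i]) : `|z| = (cn z)%:C by rewrite normc_def; case: z.
have c0 e : 0 < e -> exists N, forall l, (N <= `|l|)%N -> cn (c l) <= e.
  move=> e0; have e0C : 0 < e%:C :> R[i] by rewrite ltcR.
  move/cvgrPdist_le: c_to0 => /(_ _ e0C)[N _ HN]; exists N => l lN.
  by have := HN l lN; rewrite sub0r normrN normE lecR.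
have noo N : exists k0, forall k, (k0 <= k)%N -> (N <= n k)%N.
  by have [k0 _ H] := n_oo _ (nbhs_infty_ge N); exists k0 => k; exact: H.
have pc x e : 0 < e -> exists k0, forall k, (k0 <= k)%N -> cn (psum c (n k) x) <= e.
  move=> e0; have e0C : 0 < e%:C :> R[i] by rewrite ltcR.
  have p0 : 0 < 2 * pi :> R by rewrite mulr_gt0 // pi_gt0.
  (* Convergence is assumed on one period only; the partial sums are [2 pi]-periodic. *)
  pose m := Num.floor (x / (2 * pi)); pose y := x + 2 * pi * (- m)%:~R.
  have y02 : 0 <= y <= 2 * pi.
    have /andP[] := mem_rg1_floor (x / (2 * pi)).
    rewrite -/m ler_pdivlMr // ltr_pdivrMr // /y mulrNz => h1 h2.
    by apply/andP; split; lra.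
  move/cvgrPdist_le: (psum_to0 y y02) => /(_ _ e0C)[k0 _ H]; exists k0 => k kk.
  by have := H k kk; rewrite /= sub0r normrN normE lecR trig_psumE psum_2pi.
have grow : exists k1, forall k, (k1 <= k)%N -> (n k.+1 ^ 12 <= n k ^ 13)%N.
  (* A ratio of logarithms at most [13/12], combined with the exponent [12/7] of the energy
     inequality, yields [13/7]. *)
  have e12 : 0 < 1 / 12 :> R by lra.
  move/cvgrPdist_le: n_growth => /(_ _ e12)[k1 _ H].
  have [k2 Hk2] := noo 2; exists (maxn k1 k2) => k; rewrite geq_max => /andP[h1 h2].
  have n2 := Hk2 k h2; have n2' := Hk2 k.+1 (leqW h2).
  apply: (@expn_le_of_ln R); [lia|lia|].
  have l0 : 0 < ln (n k)%:R :> R by rewrite ln_gt0 // ltr1n.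
  have := H k h1; rewrite /= distrC ler_norml => /andP[_].
  rewrite lerBlDr ler_pdivrMr //; lra.
apply: contrapT => /existsNP[l0 cl0].
have [d [K [B [C [d0 dB pd KC van]]]]] := localization c0 noo pc (ex_intro _ l0 cl0).
apply: d0; have B0 : 0 <= B by exact: le_trans (cn_ge0 _) (dB 0).
have [|||||A HA] := @energy_bounded R (energy d) n (B ^+ 2)
  (1024 * (3 * (C ^+ 2 + 48 * B ^+ 2 + (96 * B) ^+ 2) + 1)) (2 * B ^+ 2) _ _ noo grow.
- by move=> N N'; exact: energy_mono.
- move=> N; apply: sum_zseq_const => l _.
  by rewrite lerXn2r ?nnegrE ?cn_ge0.
- by have := sqr_ge0 C; have := sqr_ge0 B; have := sqr_ge0 (96 * B); lra.
- by rewrite mulr_ge0 // sqr_ge0.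
- move=> k N nk nN E32; apply: (energy_step (K := K)) => //.
  by move=> y /KC.
exact: bounded_energy HA noo pd 0.
Qed.
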